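(* Let $n,q,N\in\mathbb{N}$, $A\in\mathbb{R}^{n\times n}$, $B\in\mathbb{R}^{n\times q}$, and let $f(x,u)=Ax+Bu$ for $x\in\mathbb{R}^n$, $u\in\mathbb{R}^q$. Let $g\colon\mathbb{R}^n\to\mathbb{R}$, $\ell_1\colon\mathbb{R}^n\to\mathbb{R}$, $\ell_2\colon\mathbb{R}^q\to\mathbb{R}$ be compositional functions that satisfy Assumption A (see context), and assume that all nodes in the compositional graphs of $g$, $\ell_1$, $\ell_2$ are $C^2$. Assume that for all $x\in\mathbb{R}^n$, $u\in\mathbb{R}^q$ it holds that $D^2g(x)\succeq0$, $D^2\ell_1(x)\succeq0$, $D^2\ell_2(u)\succ0$, and let $\ell(x,u)=\ell_1(x)+\ell_2(u)$. Let $J\colon\mathbb{R}^n\times\mathbb{R}^{qN}\to\mathbb{R}$ be $$J(x,U)=g(x_{U,N})+\sum_{k=0}^{N-1}\ell(x_{U,k},u_k),\qquad U=[u_0^\top\cdots u_{N-1}^\top]^\top .$$ Let $\Omega\subseteq\mathbb{R}^n$ be compact, and assume that for every $x\in\Omega$ there exists $U^*(x)\in\mathbb{R}^{qN}$ with $\inf_{U\in\mathbb{R}^{qN}}J(x,U)=J(x,U^*(x))$. Let $U_0\in\mathbb{R}^{qN}$ and $\gamma\in(0,\infty)$, and assume that $U^*(x)\in\mathcal{B}_\gamma(U_0)$ for all $x\in\Omega$. Let $R>1$ be large enough such that $\Omega\subseteq[-R,R]^n$, $\mathcal{B}_{2\gamma}(U_0)\subseteq[-R,R]^{qN}$, and for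 all $k\in\{1,\dots,N\}$, $x\in\Omega$, $U\in\mathcal{B}_{2\gamma}(U_0)$ it holds that $$x_{U,k}\in\left[-\tfrac R2,\tfrac R2\right]^n\quad\text{and}\quad \sum_{j=0}^{k-1}\big(\ell_1(x_{U,j})+\ell_2(u_j)\big)\in\left[-\tfrac R2,\tfrac R2\right].$$ Let $r_{\max}^{g}$, $r_{\max}^{\ell_1}$, $r_{\max}^{\ell_2}$ be part of compositional features of $g\colon[-R,R]^n\to\mathbb{R}$, $\ell_1\colon[-R,R]^n\to\mathbb{R}$, $\ell_2\colon[-R,R]^q\to\mathbb{R}$, respectively, and let $r=\max\{1,r_{\max}^{\ell_1},r_{\max}^{\ell_2},r_{\max}^{g}\}$. Then there is a constant $C>0$ such that for every $\varepsilon>0$ there exists a neural network $U_\varepsilon^{*\mathrm{NN}}\colon\Omega\to\mathbb{R}^{qN}$ such that $$\|U_\varepsilon^{*\mathrm{NN}}(x)-U^*(x)\|\le3\varepsilon\qquad\text{for all }x\in\Omega$$ and $$\operatorname{size}(U_\varepsilon^{*\mathrm{NN}})\le C\left(q\left(|\mathcal{V}_G^{\ell_1}|+|\mathcal{V}_G^{\ell_2}|+|\mathcal{V}_G^{g}|\right)\right)^{2r+1}\varepsilon^{-(8r+1)} .$$ The constant $C$ depends, in particular, on the compositional features of $g,\ell_1,\ell_2$ and on the time horizon $N$, but is independent of the accuracy parameter $\varepsilon$ and the dimension $n$.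
   Context: State evolution. For $x\in\mathbb{R}^n$ and $U=[u_0^\top\cdots u_{N-1}^\top]^\top\in\mathbb{R}^{qN}$: $x_{U,0}=x$, $x_{U,k+1}=f(x_{U,k},u_k)$. $\|\cdot\|$ is the Euclidean norm, $\mathcal{B}_\rho(y)$ is the closed Euclidean ball of radius $\rho$ centered at $y$, $D^2$ is the Hessian, and $\succeq0$, $\succ0$ mean positive semidefinite, positive definite. Compositional functions. A compositional function is a triplet $(f,\mathcal{G}^f,\mathcal{L}^f)$ (often just written $f$), where $\mathcal{G}^f=(\mathcal{V}^f,\mathcal{E}^f)$ is a directed acyclic graph and $\mathcal{L}^f\colon\mathcal{V}^f\to\mathbb{N}$ assigns layer numbers with $(g,h)\in\mathcal{E}^f\Rightarrow\mathcal{L}^f(g)<\mathcal{L}^f(h)$. Nodes without inward edges are input nodes and have layer number $0$; nodes without outward edges are output nodes and have the maximal layer number $l_{\max}^f$; all other nodes are hidden. The nodes of layer $i$ are $f_{i,1},\dots,f_{i,N_i}$. Each node $f_{i,j}$ with $i>0$ is a function of $d_{i,j}$ real variables with values in $\mathbb{R}$, where $d_{i,j}$ is the number of incoming edges of $f_{i,j}$. With $d=N_0$, an input $x\in\mathbb{R}^d$ is assigned to the input nodes, and recursively $z_{i,j}(x)$ is $f_{i,j}$ applied to the vector of the values of all predecessors of $f_{i,j}$. With $q=N_{l_{\max}^f}$, $f(x)=(z_{l_{\max}^f,1}(x),\dots,z_{l_{\max}^f,q}(x))$. $\mathcal{V}_L^f$ is the set of nodes that are input nodes or affine linear functions; $\mathcal{V}_G^f=\mathcal{V}^f\setminus\mathcal{V}_L^f$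 is the set of general nodes. Sobolev space. $W_m^\infty(K)$, for compact $K\subset\mathbb{R}^d$, is the space of functions $K\to\mathbb{R}$ whose derivatives up to order $m$ exist almost everywhere and have finite essential supremum norm $\|\cdot\|_{\infty,K}$. Assumption A. $(f,\mathcal{G}^f,\mathcal{L}^f)$ is a compositional function with $f\colon[-R,R]^d\to\mathbb{R}^q$ for some $R>0$, $d,q\in\mathbb{N}_{>0}$; each general node $f_{i,j}\in\mathcal{V}_G^f$ lies in $W_{m_{i,j}}^\infty([-R_{i,j},R_{i,j}]^{d_{i,j}})$ for some $m_{i,j},d_{i,j}\in\mathbb{N}_{>0}$, $R_{i,j}>0$; ranges and domains are compatible: if $(f_{i,j},f_{l,k})$ is an edge, the range of $f_{i,j}$ is contained in the interior of the domain of $f_{l,k}$. (Functions given on a whole Euclidean space are understood restricted to the cube.) Node Lipschitz constants. For a node $f_{i,j}$, the truncation of $f$ along layer $i$ is the function obtained by treating the values of all nodes in layers $\le i$ as free input variables and evaluating the remaining layers of the graph to the output; a Lipschitz constant $L_{i,j}^f$ associated to $f_{i,j}$ is a Lipschitz constant of this truncation with respect to the single variable replacing the value of $f_{i,j}$. Features. If $f$ satisfies Assumption A, numbers $(r_{\max}^f,\Lambda^f,L_{\max}^f,|\mathcal{V}_G^f|)\in(0,\infty)^4$ are called (compositional) features of $f$ if for all $f_{i,j}\in\mathcal{V}_G^f$: $d_{i,j}/m_{i,j}\le r_{\max}^f$; $\max\{R_{i,j}^{m_{i,j}},1\}\sum_{|\alpha|\le m_{i,j}}\|D_\alpha f_{i,j}\|_{\infty,[-R_{i,j},R_{i,j}]^{d_{i,j}}}\le\Lambda^f$;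 and $|L_{i,j}^f|\le L_{\max}^f$. Neural networks. A neural network (NN) with activation function $\sigma\colon\mathbb{R}\to\mathbb{R}$ is a compositional function $f^{\mathrm{NN}}$ in which every general node has the form $x\mapsto\sigma(w^\top x+b)$ with parameters $w\in\mathbb{R}^{d_{i,j}}$, $b\in\mathbb{R}$, and each function in the output layer is a weighted sum of the nodes in the previous layer. Its complexity $\operatorname{size}(f^{\mathrm{NN}})$ is the total number of hidden nodes. Throughout, $\sigma$ is a fixed activation function for which the following known approximation theorem (Kang and Gong) holds: if $f$ satisfies Assumption A with features $(r_{\max}^f,\Lambda^f,L_{\max}^f,|\mathcal{V}_G^f|)$, then for every positive integer $n_w$ there is an NN $f^{\mathrm{NN}}$ with $\operatorname{size}(f^{\mathrm{NN}})=n_w|\mathcal{V}_G^f|$ and $\|f(x)-f^{\mathrm{NN}}(x)\|\le C\Lambda^fL_{\max}^f|\mathcal{V}_G^f|\,n_w^{-1/r_{\max}^f}$ for all $x\in[-R,R]^d$, where $C>0$ is determined by $\{(d_{i,j},m_{i,j}):f_{i,j}\in\mathcal{V}_G^f\}$.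
   Formalization: W_m^∞ is read as genuinely Sobolev (functions continuous, derivatives of order < m Lipschitz), and network outputs may be weighted sums of nodes in any earlier layers, since with the literal definitions no activation function satisfies the Kang–Gong theorem. *)

(* Defs.v *)
From HB Require Import structures.
From mathcomp Require Import all_boot all_order all_algebra.
From mathcomp Require Import all_classical all_reals all_analysis.

Set Implicit Arguments.
Unset Strict Implicit.
Unset Printing Implicit Defensive.

Import Order.TTheory GRing.Theory Num.Theory.
Import numFieldNormedType.Exports.

Local Open Scope classical_set_scope.
Local Open Scope ring_scope.

(* Points of R^d are row vectors.  The library norm `|x| on 'rV_d is the
   maximum norm, hence the separate Euclidean norm. *)
Definition enorm (R : realType) (d : nat) (x : 'rV[R]_d) : R :=
  Num.sqrt (\sum_i x 0 i ^+ 2).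

Definition eball (R : realType) (d : nat) (y : 'rV[R]_d) (rho : R) :
  set 'rV[R]_d := [set x | enorm (x - y) <= rho].

Definition cube (R : realType) (d : nat) (rho : R) : set 'rV[R]_d :=
  [set x | forall i, `|x 0 i| <= rho].

Definition open_cube (R : realType) (d : nat) (rho : R) : set 'rV[R]_d :=
  [set x | forall i, `|x 0 i| < rho].

Definition lebesgue_null (R : realType) (d : nat) (A : set 'rV[R]_d) : Prop :=
  forall e : R, 0 < e ->
  exists (c : nat -> 'rV[R]_d) (s : nat -> R),
    [/\ forall k, 0 <= s k,
        A `<=` \bigcup_k [set x | forall i, `|x 0 i - c k 0 i| <= s k] &
        forall K : nat, \sum_(k < K) (2 * s k) ^+ d <= e].

Definition ae_cube (R : realType) (d : nat) (rho : R) (P : 'rV[R]_d -> Prop) :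
  Prop := lebesgue_null [set x | cube rho x /\ ~ P x].

(* Meaningful when f is essentially bounded on the cube (inf set0 = 0). *)
Definition ess_norm (R : realType) (d : nat) (rho : R) (f : 'rV[R]_d -> R) :
  R := inf [set M | 0 <= M /\ ae_cube rho (fun x => `|f x| <= M)].

(* Iterated partial derivative; the last direction of s is applied first. *)
Fixpoint dpart (R : realType) (d : nat) (s : seq 'I_d) (f : 'rV[R]_d -> R) :
  'rV[R]_d -> R :=
  if s is i :: s' then fun x => 'D_('e_i) (dpart s' f) x else f.

Definition dmulti (R : realType) (d m : nat) (a : {ffun 'I_d -> 'I_m.+1})
  (f : 'rV[R]_d -> R) : 'rV[R]_d -> R :=
  dpart (flatten [seq nseq (a i) i | i <- enum 'I_d]) f.

(* W_m^oo of the cube.  The derivatives up to order m exist almost everywhere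
   and are essentially bounded.  In addition f is continuous and its
   derivatives of order < m are Lipschitz: without this the almost everywhere
   derivatives would not be weak derivatives (cf. the Cantor function, or
   changes of f on a null set), and conversely the continuous representative
   of an element of the Sobolev space of the cube has this property. *)
Definition sobolev (R : realType) (d m : nat) (rho : R) (f : 'rV[R]_d -> R) :
  Prop :=
  [/\ {within cube rho, continuous f},
      forall s : seq 'I_d, (size s < m)%N ->
        [lipschitz dpart s f x | x in open_cube rho],
      forall (s : seq 'I_d) (i : 'I_d), (size s < m)%N ->
        ae_cube rho (fun x => derivable (dpart s f) x 'e_i) &
      forall s : seq 'I_d, (size s <= m)%N ->
        exists M : R, ae_cube rho (fun x => `|dpart s f x| <= M)].

Definition sobolev_norm (R : realType) (d m : nat) (rho : R)
  (f : 'rV[R]_d -> R) : R :=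
  \sum_(a : {ffun 'I_d -> 'I_m.+1} | (\sum_i a i <= m)%N)
     ess_norm rho (dmulti a f).

Definition isC2 (R : realType) (d : nat) (f : 'rV[R]_d -> R) : Prop :=
  (forall (s : seq 'I_d) (i : 'I_d) (x : 'rV[R]_d), (size s < 2)%N ->
     derivable (dpart s f) x 'e_i) /\
  (forall s : seq 'I_d, (size s <= 2)%N -> continuous (dpart s f)).

Definition hessian (R : realType) (d : nat) (f : 'rV[R]_d -> R)
  (x : 'rV[R]_d) : 'M[R]_d := \matrix_(i, j) dpart [:: i; j] f x.

Definition qform (R : realType) (d : nat) (H : 'M[R]_d) (v : 'rV[R]_d) : R :=
  (v *m H *m v^T) 0 0.

Definition psd (R : realType) (d : nat) (H : 'M[R]_d) : Prop :=
  forall v, 0 <= qform H v.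

Definition pd (R : realType) (d : nat) (H : 'M[R]_d) : Prop :=
  forall v, v != 0 -> 0 < qform H v.

(* A compositional function R^d -> R^q.  The edges are the (u, v) with
   u \in cf_preds v; the order of cf_preds v is the order of the arguments of
   the node v.  The enumeration of the nodes within a layer only matters for
   the first and the last one, where it is given by cf_in and cf_out.  The
   functions cf_fun are total: a node with domain a cube is represented by any
   extension.  cf_fun is not used at the input nodes. *)
Record compfun (R : realType) (d q : nat) := CompFun {
  cf_node : finType;
  cf_preds : cf_node -> seq cf_node;
  cf_layer : cf_node -> nat;
  cf_depth : nat;
  cf_fun : forall v : cf_node, 'rV[R]_(size (cf_preds v)) -> R;
  cf_in : 'I_d -> cf_node;
  cf_out : 'I_q -> cf_node;
  cf_preds_uniq : forall v, uniq (cf_preds v);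
  cf_edge_layer : forall u v, u \in cf_preds v -> (cf_layer u < cf_layer v)%N;
  cf_layer_max : forall v, (cf_layer v <= cf_depth)%N;
  cf_source_layer : forall v, cf_preds v = [::] -> cf_layer v = 0%N;
  cf_sink_layer : forall u, (forall v, u \notin cf_preds v) ->
    cf_layer u = cf_depth;
  cf_in_inj : injective cf_in;
  cf_in_codom : forall v, (v \in codom cf_in) = (cf_layer v == 0%N);
  cf_out_inj : injective cf_out;
  cf_out_codom : forall v, (v \in codom cf_out) = (cf_layer v == cf_depth)
}.

Section CompositionalFunctions.
Context {R : realType} {d q : nat}.
Implicit Types F : compfun R d q.

Definition cf_apply F (z : cf_node F -> R) (v : cf_node F) : R :=
  cf_fun (\row_(i < size (cf_preds v)) z (tnth (in_tuple (cf_preds v)) i)).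

(* Node values when the values z of the nodes of layers <= i are free
   variables; cf_truncE1 and cf_truncE2 are the defining equations. *)
Definition cf_trunc F (i : nat) (z : cf_node F -> R) : cf_node F -> R :=
  iter (cf_depth F)
    (fun z' v => if (cf_layer v <= i)%N then z v else cf_apply z' v) z.

Lemma cf_truncE1 F i (z : cf_node F -> R) v :
  (cf_layer v <= i)%N -> cf_trunc i z v = z v.
Proof. by rewrite /cf_trunc => vi; case: (cf_depth F) => //= k; rewrite vi. Qed.

Lemma cf_truncE2 F i (z : cf_node F -> R) v :
  (i < cf_layer v)%N -> cf_trunc i z v = cf_apply (cf_trunc i z) v.
Proof.
rewrite /cf_trunc; set step := (X in iter _ X _) => iv.
have stab k u : (cf_layer u <= k)%N -> iter k step z u = iter k.+1 step z u.
  elim: k u => [|k IH] u uk; first by rewrite /= /step (leq_trans uk).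
  change (step (iter k step z) u = step (iter k.+1 step z) u).
  rewrite {1 3}/step; case: ifP => // _.
  rewrite /cf_apply; congr (cf_fun _); apply/rowP => j; rewrite !mxE.
  apply: IH; rewrite -ltnS; apply: leq_trans uk.
  by apply: cf_edge_layer; exact: mem_tnth.
by rewrite stab ?cf_layer_max// iterS {1}/step leqNgt iv.
Qed.

Definition cf_assign F (x : 'rV[R]_d) (v : cf_node F) : R :=
  if [pick i | cf_in F i == v] is Some i then x 0 i else 0.

Definition cf_val F (x : 'rV[R]_d) : cf_node F -> R :=
  cf_trunc 0 (cf_assign x).

Definition cf_eval F (x : 'rV[R]_d) : 'rV[R]_q :=
  \row_j cf_val x (cf_out F j).

Definition affine_map (k : nat) (h : 'rV[R]_k -> R) : Prop :=
  exists (w : 'rV[R]_k) (b : R), forall y, h y = \sum_i w 0 i * y 0 i + b.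

Definition is_input F (v : cf_node F) : bool := cf_layer v == 0%N.

Definition is_output F (v : cf_node F) : bool := cf_layer v == cf_depth F.

Definition is_general F (v : cf_node F) : Prop :=
  ~~ is_input v /\ ~ affine_map (@cf_fun _ _ _ F v).

Definition general_nodes F : {set cf_node F} :=
  finset (fun v => `[< is_general v >]).

Definition cf_size F : nat :=
  #|finset (fun v : cf_node F => ~~ is_input v && ~~ is_output v)|.

(* Regularity and compatibility on the input domain [-rho, rho]^d, with orders m and radii rad
   of the domains of the nodes.  Only general nodes have an order; affine nodes
   also have a domain, so that their range makes sense. *)
Definition node_range F (rho : R) (rad : cf_node F -> R) (v : cf_node F) :
  set R :=
  if is_input v then [set t | `|t| <= rho]
  else @cf_fun _ _ _ F v @` cube (rad v).

Definition assumptionA F (rho : R) (m : cf_node F -> nat)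
  (rad : cf_node F -> R) : Prop :=
  [/\ [/\ 0 < rho, (0 < d)%N & (0 < q)%N],
      forall v, ~~ is_input v -> 0 < rad v,
      forall v, is_general v ->
        (0 < m v)%N /\ sobolev (m v) (rad v) (@cf_fun _ _ _ F v) &
      forall u v, u \in cf_preds v ->
        node_range rho rad u `<=` [set t | `|t| < rad v]].

(* Values of the layers <= i for which the truncation is defined when the
   nodes are restricted to their cubes. *)
Definition trunc_dom F (rho : R) (rad : cf_node F -> R) (i : nat) :
  set (cf_node F -> R) :=
  [set z | (forall v, is_input v -> `|z v| <= rho) /\
           (forall u v, u \in cf_preds v -> (i < cf_layer v)%N ->
              `|cf_trunc i z u| <= rad v)].

Definition node_lipschitz F (rho : R) (rad : cf_node F -> R) (v : cf_node F)
  (L : R) : Prop :=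
  let i := cf_layer v in
  let out z := \row_j cf_trunc i z (cf_out F j) in
  forall z z' : cf_node F -> R,
    trunc_dom rho rad i z -> trunc_dom rho rad i z' ->
    (forall u, u != v -> z u = z' u) ->
    enorm (out z - out z') <= L * `|z v - z' v|.

End CompositionalFunctions.

Record features (R : realType) := Features {
  ft_rmax : R;
  ft_Lambda : R;
  ft_Lmax : R;
  ft_general : nat
}.

Definition is_features (R : realType) (d q : nat) (F : compfun R d q)
  (rho : R) (m : cf_node F -> nat) (rad : cf_node F -> R) (phi : features R) :
  Prop :=
  [/\ [/\ 0 < ft_rmax phi, 0 < ft_Lambda phi, 0 < ft_Lmax phi &
          (0 < ft_general phi)%N],
      ft_general phi = #|general_nodes F| &
      forall v : cf_node F, is_general v ->
        [/\ (size (cf_preds v))%:R / (m v)%:R <= ft_rmax phi,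
            Num.max (rad v ^+ m v) 1
              * sobolev_norm (m v) (rad v) (@cf_fun _ _ _ F v)
              <= ft_Lambda phi &
            exists L, node_lipschitz rho rad v L /\ `|L| <= ft_Lmax phi]].

Definition dm_pairs (R : realType) (d q : nat) (F : compfun R d q)
  (m : cf_node F -> nat) : set (nat * nat) :=
  [set (size (cf_preds v), m v) | v in [set v | is_general v]].

(* As for every compositional function, edges may skip layers; in particular
   an output is a weighted sum of nodes of the layers before it. *)
Definition is_NN (R : realType) (sigma : R -> R) (d q : nat)
  (F : compfun R d q) : Prop :=
  [/\ (0 < cf_depth F)%N,
      forall v : cf_node F, is_general v ->
        exists (w : 'rV[R]_(size (cf_preds v))) (b : R),
          forall y, cf_fun (v := v) y = sigma (\sum_i w 0 i * y 0 i + b) &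
      forall v : cf_node F, is_output v ->
        exists w : 'rV[R]_(size (cf_preds v)),
          forall y, cf_fun (v := v) y = \sum_i w 0 i * y 0 i].

(* The approximation theorem of Kang and Gong for the activation sigma; its
   constant is a function K of the set of the pairs (d_ij, m_ij). *)
Definition kang_gong (R : realType) (sigma : R -> R) : Prop :=
  exists K : set (nat * nat) -> R,
    (forall S, 0 < K S) /\
    forall (d q : nat) (F : compfun R d q) (rho : R) (m : cf_node F -> nat)
      (rad : cf_node F -> R) (phi : features R),
      assumptionA rho m rad -> is_features rho m rad phi ->
      forall nw : nat, (0 < nw)%N ->
      exists G : compfun R d q,
        [/\ is_NN sigma G,
            cf_size G = (nw * ft_general phi)%N &
            forall x, cube rho x ->
              enorm (cf_eval F x - cf_eval G x) <=
                K (dm_pairs m) * ft_Lambda phi * ft_Lmax phi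
                * (ft_general phi)%:R * nw%:R `^ (- (ft_rmax phi)^-1)].

Definition cf_eval1 (R : realType) (d : nat) (F : compfun R d 1)
  (x : 'rV[R]_d) : R := cf_eval F x 0 0.

Definition all_nodes_C2 (R : realType) (d q : nat) (F : compfun R d q) : Prop :=
  forall v : cf_node F, ~~ is_input v -> isC2 (@cf_fun _ _ _ F v).

(* u_k, the k-th block of U = [u_0 ... u_(N-1)] (0 if k >= N). *)
Definition control (R : realType) (N q : nat) (U : 'rV[R]_(N * q)) (k : nat) :
  'rV[R]_q := if insub k is Some i then row i (vec_mx U) else 0.

Fixpoint state (R : realType) (n N q : nat)
  (f : 'rV[R]_n -> 'rV[R]_q -> 'rV[R]_n) (x : 'rV[R]_n) (U : 'rV[R]_(N * q))
  (k : nat) : 'rV[R]_n :=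
  if k is k'.+1 then f (state f x U k') (control U k') else x.

Definition lin_dyn (R : realType) (n q : nat) (A : 'M[R]_n) (B : 'M[R]_(n, q))
  (x : 'rV[R]_n) (u : 'rV[R]_q) : 'rV[R]_n := x *m A^T + u *m B^T.

Definition running_cost (R : realType) (n N q : nat)
  (f : 'rV[R]_n -> 'rV[R]_q -> 'rV[R]_n) (l1 : 'rV[R]_n -> R)
  (l2 : 'rV[R]_q -> R) (k : nat) (x : 'rV[R]_n) (U : 'rV[R]_(N * q)) : R :=
  \sum_(j < k) (l1 (state f x U j) + l2 (control U j)).

Definition cost (R : realType) (n N q : nat)
  (f : 'rV[R]_n -> 'rV[R]_q -> 'rV[R]_n) (g l1 : 'rV[R]_n -> R)
  (l2 : 'rV[R]_q -> R) (x : 'rV[R]_n) (U : 'rV[R]_(N * q)) : R :=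
  g (state f x U N) + running_cost f l1 l2 N x U.

(* Rayleigh quotients of the Hessian of J in U over Om x B: their inf and sup
   are the extreme eigenvalues occurring there. *)
Definition curvatures (R : realType) (n p : nat)
  (J : 'rV[R]_n -> 'rV[R]_p -> R) (Om : set 'rV[R]_n) (B : set 'rV[R]_p) :
  set R :=
  [set t | exists x U v,
     [/\ Om x, B U, enorm v = 1 & t = qform (hessian (J x) U) v]].

(* The quantities the complexity constant may depend on.  Neither the accuracy
   nor the state dimension is among them. *)
Record problem_data (R : realType) := ProblemData {
  pd_horizon : nat;
  pd_g : features R;
  pd_l1 : features R;
  pd_l2 : features R;
  pd_dm_g : set (nat * nat);
  pd_dm_l1 : set (nat * nat);
  pd_dm_l2 : set (nat * nat);
  pd_rho : R;
  pd_gamma : R;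
  pd_center : R;
  pd_curv_min : R;
  pd_curv_max : R
}.

(* Main.v *)
Require Import Defs.
From HB Require Import structures.
From mathcomp Require Import all_boot all_order all_algebra.
From mathcomp Require Import all_classical all_reals all_analysis.
From mathcomp Require Import ring lra zify.
Import Order.TTheory GRing.Theory Num.Theory.
Import numFieldNormedType.Exports.
Local Open Scope classical_set_scope.
Local Open Scope ring_scope.

(** The controller is the gradient method for the convex problem min_U J(x, U),
    run for finitely many steps with finite differences of an approximate cost,
    and written out as one network.

    On the ball of radius 2 gamma around U0 the Hessian of J(x, .) lies between
    mu > 0 and M: the states are affine in the controls, so the second derivative
    of J along v is a sum of second derivatives of the cost terms ([qform_cost]),
    in which g and l1 contribute nonnegative amounts and l2 a positive one, uniform
    by compactness ([curvature_bounds], [cost_curvature]). A gradient step of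
    length mu / M^2 therefore contracts the distance to U*(x) by 1 - kappa with
    kappa = mu^2 / (2 M^2) ([gradient_step]); this needs the Hessian to be symmetric
    ([clairaut]). Starting at U0, the iterates stay in the ball even when the
    gradients are only approximate, and reach distance 2 s after about
    gamma / (kappa s) steps ([descent_error], [geometric_decay]).

    Forward differences of step t of a cost known up to delta have error
    M t + 2 delta / t in each of the N q components ([forward_difference]), so
    t ~ s / (N q) and delta ~ (s / (N q))^2 suffice. The approximation theorem is
    applied to g, l1 and l2 one at a time and gives this accuracy with O((q / s)^(2 r))
    nodes. The states need no nodes: as affine functions of the initial state and
    of the controls they are absorbed in the weights of the nodes that read them
    ([aspan_subst], [realizable_cost]), and this is why the state dimension does
    not enter. Each of the O(1 / s) steps evaluates the cost N q + 1 times, which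
    makes O((q / s)^(2 r + 1)) nodes altogether ([size_bound]); s is a fixed
    multiple of eps.

    Networks are handled as lists of functions ([net], [aspan]), into which every
    network graph unfolds ([net_of_NN]) and from which a graph is built again at
    the end ([NN_of_net]). *)

(** * Networks as lists of activations *)

Section Nets.
Context {R : realType} (sigma : R -> R).

(** The functions that a next node may read: affine combinations of the inputs
    and of the entries of hs. *)
Inductive aspan {n : nat} (hs : seq ('rV[R]_n -> R)) : ('rV[R]_n -> R) -> Prop :=
| aspan_const b : aspan hs (fun=> b)
| aspan_coord i : aspan hs (fun x => x 0 i)
| aspan_nth j : (j < size hs)%N -> aspan hs (nth (fun=> 0) hs j)
| aspan_add f g : aspan hs f -> aspan hs g -> aspan hs (fun x => f x + g x)
| aspan_scale c f : aspan hs f -> aspan hs (fun x => c * f x).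

(** A network read as a list: every entry is the activation applied to an affine
    combination of the inputs and of the entries before it. Affine nodes need no
    entry, so that concatenation and substitution, the two operations from which
    the controller is built, add up sizes exactly. *)
Definition net {n : nat} (hs : seq ('rV[R]_n -> R)) : Prop :=
  forall j, (j < size hs)%N ->
  exists2 a, aspan (take j hs) a & nth (fun=> 0) hs j = sigma \o a.

Lemma aspan_sum n (hs : seq ('rV[R]_n -> R)) (I : Type) (r : seq I)
    (F : I -> 'rV[R]_n -> R) :
  (forall i, aspan hs (F i)) -> aspan hs (fun x => \sum_(i <- r) F i x).
Proof.
move=> FP; elim: r => [|i r IH].
  under [X in aspan _ X]eq_fun do rewrite big_nil.
  exact: aspan_const.
under [X in aspan _ X]eq_fun do rewrite big_cons.
exact: aspan_add.
Qed.

Lemma aspan_trans n (hs ks : seq ('rV[R]_n -> R)) f :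
  (forall j, (j < size hs)%N -> aspan ks (nth (fun=> 0) hs j)) ->
  aspan hs f -> aspan ks f.
Proof.
move=> hk; elim=> [b|i|j /hk//|f1 g _ Hf _ Hg|c f1 _ Hf].
- exact: aspan_const.
- exact: aspan_coord.
- exact: aspan_add.
- exact: aspan_scale.
Qed.

Lemma aspan_catl n (hs ks : seq ('rV[R]_n -> R)) f :
  aspan hs f -> aspan (hs ++ ks) f.
Proof.
apply: aspan_trans => j jh.
have <- : nth (fun=> 0) (hs ++ ks) j = nth (fun=> 0) hs j by rewrite nth_cat jh.
by apply: aspan_nth; rewrite size_cat ltn_addr.
Qed.

Lemma aspan_catr n (hs ks : seq ('rV[R]_n -> R)) f :
  aspan ks f -> aspan (hs ++ ks) f.
Proof.
apply: aspan_trans => j jk.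
have <- : nth (fun=> 0) (hs ++ ks) (size hs + j) = nth (fun=> 0) ks j.
  by rewrite nth_cat -ltn_subRL subnn ltn0 addKn.
by apply: aspan_nth; rewrite size_cat ltn_add2l.
Qed.

Lemma net_rcons n (hs : seq ('rV[R]_n -> R)) a :
  net hs -> aspan hs a -> net (rcons hs (sigma \o a)).
Proof.
move=> hsN aP j; rewrite size_rcons ltnS leq_eqVlt => /orP[/eqP->|jh].
  by exists a; rewrite ?nth_rcons ?ltnn ?eqxx// -cats1 take_size_cat.
have [a' a'P e] := hsN _ jh; exists a'; last by rewrite nth_rcons jh.
by rewrite -cats1 take_cat jh.
Qed.

(** Substituting an affinely readable map for the inputs of a net costs no
    node, because the affine map is absorbed in the weights. *)
Lemma aspan_subst n m (ks : seq ('rV[R]_n -> R)) (hs : seq ('rV[R]_m -> R))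
    (phi : 'rV[R]_n -> 'rV[R]_m) f :
  (forall j, aspan ks (fun x => phi x 0 j)) -> aspan hs f ->
  aspan (ks ++ [seq h \o phi | h <- hs]) (f \o phi).
Proof.
move=> phiP; elim=> [b|i|j jh|f1 g _ Hf _ Hg|c f1 _ Hf].
- exact: aspan_const.
- exact/aspan_catl/phiP.
- apply: aspan_catr.
  have <- : nth (fun=> 0) [seq h \o phi | h <- hs] j = nth (fun=> 0) hs j \o phi.
    by rewrite (nth_map (fun=> 0)).
  by apply: aspan_nth; rewrite size_map.
- exact: aspan_add.
- exact: aspan_scale.
Qed.

Lemma net_subst n m (ks : seq ('rV[R]_n -> R)) (hs : seq ('rV[R]_m -> R))
    (phi : 'rV[R]_n -> 'rV[R]_m) :
  (forall j, aspan ks (fun x => phi x 0 j)) -> net ks -> net hs ->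
  net (ks ++ [seq h \o phi | h <- hs]).
Proof.
move=> phiP ksN hsN j; rewrite size_cat size_map nth_cat take_cat.
case: (ltnP j (size ks)) => [jk _|kj]; first exact: (ksN j jk).
rewrite -ltn_subLR// => jh; have [a aP e] := hsN _ jh.
exists (a \o phi); last by rewrite (nth_map (fun=> 0))// e.
by rewrite -map_take; apply: aspan_subst.
Qed.

(** The weights from which a graph is built are read off this normal form. *)
Lemma aspan_normal n (hs : seq ('rV[R]_n -> R)) f : aspan hs f ->
  exists (w : 'I_n -> R) (c : nat -> R) (b : R), forall x,
    f x = \sum_i w i * x 0 i + \sum_(j < size hs) c j * nth (fun=> 0) hs j x + b.
Proof.
elim=> [b|i|j jh|f1 g _ [w [c [b e]]] _ [w' [c' [b' e']]]|k f1 _ [w [c [b e]]]].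
- exists (fun=> 0), (fun=> 0), b => x.
  by rewrite !big1 ?add0r// => i _; rewrite mul0r.
- exists (fun k => (k == i)%:R), (fun=> 0), 0 => x.
  rewrite (bigD1 i)//= eqxx mul1r !big1 ?addr0// => [k _|k /negbTE ->];
  by rewrite mul0r.
- exists (fun=> 0), (fun k => (k == j)%:R), 0 => x.
  rewrite big1 ?add0r ?addr0; last by move=> i _; rewrite mul0r.
  rewrite (bigD1 (Ordinal jh))//= eqxx mul1r big1 ?addr0// => k.
  by rewrite -val_eqE /= => /negbTE ->; rewrite mul0r.
- exists (fun i => w i + w' i), (fun i => c i + c' i), (b + b') => x.
  under eq_bigr do rewrite mulrDl; under [X in _ = _ + X + _]eq_bigr do rewrite mulrDl.
  rewrite e e' !big_split /=.
  by ring.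
- exists (fun i => k * w i), (fun i => k * c i), (k * b) => x.
  rewrite e !mulrDr !mulr_sumr; congr (_ + _ + _);
  by apply: eq_bigr => i _; rewrite mulrA.
Qed.

End Nets.

(** * Passing between networks and lists *)

Section NetsAndGraphs.
Context {R : realType} (sigma : R -> R).

(** Adding one layer: its nodes do not read each other, so all of them read hs
    and only those that are not affine need a new entry. *)
Lemma net_extend n (hs : seq ('rV[R]_n -> R)) (T : Type) (F : T -> 'rV[R]_n -> R)
    (costly : pred T) (vs : seq T) :
  net sigma hs ->
  (forall v, aspan hs (F v) \/
     costly v /\ exists2 a, aspan hs a & F v = sigma \o a) ->
  exists ls, [/\ net sigma (hs ++ ls), (size ls <= count costly vs)%N &
    forall k, (k < size vs)%N -> forall v0, aspan (hs ++ ls) (F (nth v0 vs k))].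
Proof.
move=> hsN FP; elim: vs => [|v vs [ls [lsN lss lsP]]].
  by exists [::]; rewrite cats0; split.
have [Fv|[cv [a aP Fv]]] := FP v.
- exists ls; split=> //=; first exact: leq_trans lss (leq_addl _ _).
  by case=> [_ v0|k kv v0]; [exact: aspan_catl|exact: lsP].
- exists (rcons ls (F v)); split.
  + by rewrite -rcons_cat Fv; apply: net_rcons => //; apply: aspan_catl.
  + by rewrite size_rcons /= cv add1n.
  + rewrite -rcons_cat; case=> [_ v0|k kv v0] /=; last first.
      by rewrite -cats1; apply/aspan_catl/lsP.
    have := @aspan_nth _ _ (rcons (hs ++ ls) (F v)) (size (hs ++ ls)).
    by rewrite size_rcons nth_rcons ltnn eqxx; exact.
Qed.

(** The nodes are processed layer by layer. The size can only decrease, because an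
    affine node stays in the affine span and needs no entry. *)
Lemma net_of_NN n p (G : compfun R n p) : is_NN sigma G ->
  exists hs, [/\ net sigma hs, (size hs <= cf_size G)%N &
    forall j, aspan hs (fun x => cf_eval G x 0 j)].
Proof.
move=> [d0 Gsig Gout].
pose hid (v : cf_node G) := ~~ is_input v && ~~ is_output v.
have cnt k : exists hs, [/\ net sigma hs,
    (size hs <= \sum_v (hid v && (cf_layer v <= k)%N))%N &
    forall v, (cf_layer v <= k)%N -> aspan hs (fun x => @cf_val _ _ _ G x v)].
  elim: k => [|k [hs [hsN hss hsP]]].
    exists [::]; split=> // v; rewrite leqn0 -cf_in_codom => /codomP[i ->].
    under [X in aspan _ X]eq_fun => x.
      rewrite /cf_val cf_truncE1; last first.
        by rewrite leqn0 -cf_in_codom codom_f.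
      rewrite /cf_assign; case: pickP => [i'|/(_ i)]; last by rewrite eqxx.
      move=> /eqP /cf_in_inj ->.
      over.
    exact: aspan_coord.
  pose F (v : cf_node G) : 'rV[R]_n -> R :=
    if cf_layer v == k.+1 then fun x => @cf_val _ _ _ G x v else fun=> 0.
  have [v|ls [lsN lss lsP]] := @net_extend n hs _ F
     (fun v => hid v && (cf_layer v == k.+1)) (enum (cf_node G)) hsN.
    rewrite /F; case: eqP => vk; last by left; apply: aspan_const.
    have vE : (fun x => @cf_val _ _ _ G x v) =
        fun x => cf_fun (\row_(i < size (cf_preds v))
          @cf_val _ _ _ G x (tnth (in_tuple (cf_preds v)) i)).
      by apply/funext => x; rewrite /cf_val cf_truncE2 ?vk.
    have aff (w : 'rV[R]_(size (cf_preds v))) b : aspan hs (fun x =>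
       \sum_i w 0 i * (\row_(i < size (cf_preds v))
          @cf_val _ _ _ G x (tnth (in_tuple (cf_preds v)) i)) 0 i + b).
      apply: aspan_add; last exact: aspan_const.
      apply: aspan_sum => i; under [X in aspan _ X]eq_fun do rewrite mxE.
      apply: aspan_scale; apply: hsP; rewrite -ltnS -vk.
      by apply: cf_edge_layer; exact: mem_tnth.
    have [vo|vo] := boolP (is_output v).
      left; have [w wP] := Gout v vo.
      have := aff w 0; congr aspan; rewrite vE; apply/funext => x.
      by rewrite wP addr0.
    have vi : ~~ is_input v by rewrite /is_input vk.
    have [[w [b wP]]|vg] := pselect (affine_map (@cf_fun _ _ _ G v)).
      left; have := aff w b; congr aspan; rewrite vE; apply/funext => x.
      by rewrite wP.
    right; split; first by rewrite /hid vi vo.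
    have [w [b wP]] := Gsig v (conj vi vg).
    exists (fun x => \sum_i w 0 i * (\row_(i < size (cf_preds v))
          @cf_val _ _ _ G x (tnth (in_tuple (cf_preds v)) i)) 0 i + b).
      exact: aff.
    by rewrite vE; apply/funext => x /=; rewrite wP.
  exists (hs ++ ls); split=> //.
    rewrite size_cat (leq_trans (leq_add hss lss))//.
    rewrite -sum1_count big_enum_cond [X in (_ + X)%N]big_mkcond -big_split /=.
    apply: leq_sum => v _; case: (hid v) => //=.
    by case: (ltngtP (cf_layer v) k.+1) => vk /=; lia.
  move=> v; rewrite leq_eqVlt => /orP[vk|]; last first.
    by rewrite ltnS => /hsP; exact: aspan_catl.
  have /lsP/(_ v) : (index v (enum (cf_node G)) < size (enum (cf_node G)))%N.
    by rewrite index_mem mem_enum.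
  by rewrite nth_index ?mem_enum// /F vk.
have [hs [hsN hss hsP]] := cnt (cf_depth G).
exists hs; split=> //.
  rewrite (leq_trans hss)// /cf_size -sum1_card [leqRHS]big_mkcond /=.
  by apply: leq_sum => v _; rewrite inE -/(hid v); case: (hid v) => //=; exact: leq_b1.
move=> j; under [X in aspan _ X]eq_fun do rewrite mxE.
exact/hsP/cf_layer_max.
Qed.

(** A graph in which every node reads all nodes of the lower layers, with weight 0
    where nothing is to be read. The hidden nodes lie in different layers. No
    node but the inputs is then a source and no node but the outputs a sink, as
    the definition of compositional functions demands. *)
Section DenseNetwork.
Variables (n m p : nat) (n0 : (0 < n)%N) (p0 : (0 < p)%N).
Variable isone : pred 'I_m.

Definition dense_node := ('I_n + 'I_m + 'I_p)%type.

Variable W : dense_node -> dense_node -> R.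

Definition dense_layer (v : dense_node) : nat :=
  match v with
  | inl (inl _) => 0
  | inl (inr j) => j.+1
  | inr _ => m.+1
  end.

Definition dense_preds (v : dense_node) : seq dense_node :=
  [seq u <- enum (dense_node : finType) | (dense_layer u < dense_layer v)%N].

Definition dense_fun (v : dense_node) (y : 'rV[R]_(size (dense_preds v))) : R :=
  let a := \sum_i W v (tnth (in_tuple (dense_preds v)) i) * y 0 i in
  match v with
  | inl (inr j) => if isone j then 1 else sigma a
  | _ => a
  end.

Lemma mem_dense_preds u v : (u \in dense_preds v) = (dense_layer u < dense_layer v)%N.
Proof. by rewrite mem_filter mem_enum andbT. Qed.

Lemma dense_preds_uniq v : uniq (dense_preds v).
Proof. by rewrite filter_uniq// enum_uniq. Qed.

Lemma dense_edge_layer u v : u \in dense_preds v -> (dense_layer u < dense_layer v)%N.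
Proof. by rewrite mem_dense_preds. Qed.

Lemma dense_layer_max v : (dense_layer v <= m.+1)%N.
Proof. by case: v => [[i|j]|k] //=; rewrite ltnS ltnW. Qed.

Lemma dense_source_layer v : dense_preds v = [::] -> dense_layer v = 0%N.
Proof.
move=> v0; apply/eqP; rewrite -leqn0 leqNgt; apply/negP => vl.
have : inl (inl (Ordinal n0)) \in dense_preds v by rewrite mem_dense_preds.
by rewrite v0.
Qed.

Lemma dense_sink_layer u : (forall v, u \notin dense_preds v) -> dense_layer u = m.+1.
Proof.
move=> /(_ (inr (Ordinal p0))); rewrite mem_dense_preds -leqNgt => um.
by apply/eqP; rewrite eqn_leq dense_layer_max.
Qed.

Lemma dense_in_inj : injective (fun i : 'I_n => inl (inl i) : dense_node).
Proof. by move=> i j []. Qed.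

Lemma dense_in_codom v : (v \in codom (fun i : 'I_n => inl (inl i) : dense_node))
  = (dense_layer v == 0%N).
Proof.
case: v => [[i|j]|k] /=; first by rewrite eqxx; apply/codomP; eexists.
- by apply/negbTE/negP => /codomP[i0].
- by apply/negbTE/negP => /codomP[i0].
Qed.

Lemma dense_out_inj : injective (fun k : 'I_p => inr k : dense_node).
Proof. by move=> i j []. Qed.

Lemma dense_out_codom v : (v \in codom (fun k : 'I_p => inr k : dense_node))
  = (dense_layer v == m.+1).
Proof.
case: v => [[i|j]|k] /=; last by rewrite eqxx; apply/codomP; eexists.
- by apply/negbTE/negP => /codomP[i0].
- by rewrite eqSS (ltn_eqF (ltn_ord j)); apply/negbTE/negP => /codomP[i0].
Qed.

Definition dense_NN : compfun R n p :=
  CompFun dense_fun dense_preds_uniq dense_edge_layer dense_layer_max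
    dense_source_layer dense_sink_layer
    dense_in_inj dense_in_codom dense_out_inj dense_out_codom.

Lemma dense_NN_is_NN : is_NN sigma dense_NN.
Proof.
split=> //.
- move=> [[i|j]|k] [vi vg]; first by [].
  + exists (\row_i W (inl (inr j)) (tnth (in_tuple (dense_preds (inl (inr j)))) i)), 0.
    move=> y /=; case: ifP => j1; last first.
      by rewrite addr0; congr sigma; apply: eq_bigr => i _; rewrite mxE.
    exfalso; apply: vg; exists 0, 1 => z /=; rewrite j1 big1 ?add0r// => i _.
    by rewrite mxE mul0r.
  + exfalso; apply: vg.
    exists (\row_i W (inr k) (tnth (in_tuple (dense_preds (inr k))) i)), 0 => z /=.
    by rewrite addr0; apply: eq_bigr => i _; rewrite mxE.
- move=> [[i|j]|k]; rewrite /is_output //=.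
    by rewrite eqSS (ltn_eqF (ltn_ord j)).
  exists (\row_i W (inr k) (tnth (in_tuple (dense_preds (inr k))) i)) => z /=.
  by apply: eq_bigr => i _; rewrite mxE.
Qed.

Lemma dense_NN_size : cf_size dense_NN = m.
Proof.
rewrite /cf_size -sum1_card.
rewrite (eq_bigl (fun v : dense_node => if v is inl (inr _) then true else false)).
  rewrite big_sumType /= big_sumType /= big_pred0// big_const_ord iter_addn.
  by rewrite big_pred0// mul1n !addn0.
case=> [[i|j]|k]; rewrite inE /is_input /is_output //=.
  by rewrite eqSS (ltn_eqF (ltn_ord j)).
by rewrite eqxx.
Qed.

Lemma dense_NN_val x v : (0 < dense_layer v)%N ->
  @cf_val _ _ _ dense_NN x v =
  let a := \sum_(u | (dense_layer u < dense_layer v)%N)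
    W v u * @cf_val _ _ _ dense_NN x u in
  match v with
  | inl (inr j) => if isone j then 1 else sigma a
  | _ => a
  end.
Proof.
move=> v0; rewrite {1}/cf_val cf_truncE2// /cf_apply /= /dense_fun.
suff -> : \sum_(i < size (dense_preds v)) W v (tnth (in_tuple (dense_preds v)) i) *
    (\row_(i0 < size (dense_preds v))
       @cf_val _ _ _ dense_NN x (tnth (in_tuple (dense_preds v)) i0)) 0 i =
  \sum_(u | (dense_layer u < dense_layer v)%N) W v u * @cf_val _ _ _ dense_NN x u by [].
under eq_bigr do rewrite mxE.
rewrite -(big_tnth _ _ (dense_preds v) xpredT
  (fun u => W v u * @cf_val _ _ _ dense_NN x u)).
by rewrite big_filter big_enum_cond.
Qed.

Lemma dense_NN_in x i : @cf_val _ _ _ dense_NN x (inl (inl i)) = x 0 i.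
Proof.
rewrite /cf_val cf_truncE1// /cf_assign; case: pickP => [i' /eqP[->]//|].
by move=> /(_ i); rewrite eqxx.
Qed.

End DenseNetwork.
Arguments dense_layer {n m p} v.

Lemma zero_NN n p : (0 < n)%N -> (0 < p)%N ->
  exists G : compfun R n p,
    [/\ is_NN sigma G, cf_size G = 0%N & forall x, cf_eval G x = 0].
Proof.
move=> n0 p0; exists (dense_NN n 0 p n0 p0 (fun=> false) (fun _ _ => 0)).
split; [exact: dense_NN_is_NN|exact: dense_NN_size|move=> x].
apply/rowP => j; rewrite !mxE /= dense_NN_val//= big1// => u _.
by rewrite mul0r.
Qed.

(** The output nodes of a network carry no bias. One more hidden node, with the
    constant value 1, supplies the biases of all nodes. *)
Lemma NN_of_net n p (hs : seq ('rV[R]_n -> R)) (F : 'I_p -> 'rV[R]_n -> R) :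
  (0 < n)%N -> (0 < p)%N -> net sigma hs -> (forall k, aspan hs (F k)) ->
  exists G : compfun R n p,
    [/\ is_NN sigma G, cf_size G = (size hs).+1 &
        forall x k, cf_eval G x 0 k = F k x].
Proof.
move=> n0 p0 hsN FP.
pose s := size hs; pose h k := nth (fun=> 0 : R) hs k.
have norm (hs' : seq ('rV[R]_n -> R)) f : aspan hs' f ->
  {wcb : ('I_n -> R) * (nat -> R) * R |
    forall x, f x = \sum_i wcb.1.1 i * x 0 i +
      \sum_(j < size hs') wcb.1.2 j * nth (fun=> 0) hs' j x + wcb.2}.
  by move=> /aspan_normal/cid[w /cid[c /cid[b e]]]; exists (w, c, b).
have hidw (k : nat) : {wcb : ('I_n -> R) * (nat -> R) * R |
    (k < s)%N -> forall x, h k x = sigma (\sum_i wcb.1.1 i * x 0 i +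
      \sum_(j < k) wcb.1.2 j * h j x + wcb.2)}.
  have [ks|] := boolP (k < s)%N; last by exists (fun=> 0, fun=> 0, 0).
  have /cid2[a /norm[wcb e] ha] := hsN k ks.
  exists wcb => _ x; rewrite /h ha /= e; congr (sigma (_ + _ + _)).
  rewrite size_take ks; apply: eq_bigr => j _.
  by rewrite nth_take.
pose hw k := sval (hidw k).
pose ow k := sval (norm _ _ (FP k)).
pose rd (wcb : ('I_n -> R) * (nat -> R) * R) (u : dense_node n s.+1 p) : R :=
  match u with
  | inl (inl i) => wcb.1.1 i
  | inl (inr j) => if (j : nat) is j'.+1 then wcb.1.2 j' else wcb.2
  | inr _ => 0
  end.
pose W (v u : dense_node n s.+1 p) : R :=
  match v with
  | inl (inl _) => 0
  | inl (inr j) => rd (hw j.-1) u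
  | inr k => rd (ow k) u
  end.
pose G := dense_NN n s.+1 p n0 p0 (fun j : 'I_s.+1 => j == ord0) W.
have sumE (wcb : ('I_n -> R) * (nat -> R) * R) (z : dense_node n s.+1 p -> R) k
    (x : 'rV[R]_n) :
    (k <= s)%N ->
    (forall i, z (inl (inl i)) = x 0 i) -> z (inl (inr ord0)) = 1 ->
    (forall j : 'I_s.+1, (0 < j <= k)%N -> z (inl (inr j)) = h j.-1 x) ->
    \sum_(u | (dense_layer u < k.+2)%N) rd wcb u * z u =
    \sum_i wcb.1.1 i * x 0 i + \sum_(j < k) wcb.1.2 j * h j x + wcb.2.
  move=> ks zi z1 zh; rewrite big_sumType /= big_sumType /=.
  rewrite [X in _ + X]big1 ?addr0; last by move=> i _; rewrite mul0r.
  rewrite -addrA; congr (_ + _); first by apply: eq_bigr => i _; rewrite zi.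
  rewrite (bigD1 ord0)//= z1 mulr1 addrC; congr (_ + _).
  rewrite big_mkcond big_ord_recl /= add0r.
  rewrite (big_ord_widen s (fun j => wcb.1.2 j * h j x))// [RHS]big_mkcond /=.
  apply: eq_bigr => j _; rewrite /bump /= add1n andbT ltnS.
  by rewrite ltnS; case: ifP => // jk; rewrite zh//= /bump /= add1n.
have val x k : (k <= s)%N -> forall j : 'I_s.+1, (j <= k)%N ->
    @cf_val _ _ _ G x (inl (inr j)) = if (j : nat) is j'.+1 then h j' x else 1.
  elim: k => [|k IH] ks j.
    by rewrite leqn0 => j0; rewrite dense_NN_val//= -val_eqE /= j0 (eqP j0).
  rewrite leq_eqVlt => /orP[/eqP jk|]; last by rewrite ltnS => /IH; apply; exact: ltnW.
  rewrite dense_NN_val//= -val_eqE /= jk /=.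
  rewrite (svalP (hidw k) ks); congr sigma.
  rewrite (sumE (hw k) _ k x (ltnW ks))//.
  - by move=> i; rewrite dense_NN_in.
  - by move=> i /andP[i0 ik]; rewrite IH ?(ltnW ks)//; case: (i : nat) i0.
exists G; split; [exact: dense_NN_is_NN|exact: dense_NN_size|move=> x k].
rewrite mxE dense_NN_val//= (sumE (ow k) _ s x)//.
- by rewrite (svalP (norm _ _ (FP k))).
- by move=> i; rewrite dense_NN_in.
- by move=> i /andP[i0 ik]; rewrite (val x s)//; case: (i : nat) i0.
Qed.

End NetsAndGraphs.

(** * Calculus with continuous partial derivatives *)

Section Calculus.
Context {R : realType}.

Lemma continuous_row (T : Type) k (z : T -> 'rV[R]_k) (F : set_system T)
    (y : 'rV[R]_k) : Filter F ->
  (forall j, z t 0 j @[t --> F] --> y 0 j) -> z t @[t --> F] --> y.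
Proof.
move=> FF zP; apply/cvgrPdist_le => /= e e0; near=> t.
rewrite /Num.Def.normr/= mx_normrE (bigmax_le _ (ltW e0))//= => i _.
rewrite !mxE ord1; move: i; near: t; apply: filter_forall => /= -[i j] /=.
exact: ((cvgrPdist_le _ _).1 (zP j)).
Unshelve. all: by end_near. Qed.

Lemma line_derive (V : normedModType R) (f : V -> R) x v t :
  derivable f (x + t *: v) v ->
  is_derive t 1 (fun s => f (x + s *: v)) ('D_v f (x + t *: v)).
Proof.
have e : (fun h => h^-1 *: ((f \o shift (x + t *: v)) (h *: v) - f (x + t *: v))) =
  (fun h => h^-1 *: (((fun s => f (x + s *: v)) \o shift t) (h *: 1) - f (x + t *: v))).
  apply/funext => h /=; congr (_ *: (f _ - _)).
  by rewrite [h *: 1]mulr1 scalerDl addrCA.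
by move=> fd; apply: DeriveDef; rewrite /derivable /derive -e.
Qed.

(** The mean value theorem on the segment from 0 to a, whatever the sign of a. *)
Lemma mvt0 (F dF : R -> R) (a : R) : (forall t : R, is_derive t 1 F (dF t)) ->
  exists t, [/\ 0 <= t, t <= 1 & F a - F 0 = dF (t * a) * a].
Proof.
move=> FP.
have Fd t : derivable F t 1 by case: (FP t).
have [a0|a0] := leP 0 a.
  have [|c] := @MVT_segment R F dF 0 a a0 (fun t _ => FP t).
    exact: derivable_within_continuous.
  rewrite in_itv/= subr0 => /andP[c0 ca] e.
  move: a0; rewrite le_eqVlt => /orP[/eqP a0|a0].
    by exists 0; rewrite lexx ler01 -a0 subrr mulr0.
  exists (c / a); rewrite divfK ?gt_eqF//; split=> //.
    by rewrite divr_ge0// ltW.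
  by rewrite ler_pdivrMr// mul1r.
have [|c] := @MVT_segment R F dF a 0 (ltW a0) (fun t _ => FP t).
  exact: derivable_within_continuous.
rewrite in_itv/= sub0r => /andP[c0 ca] e.
exists (c / a); rewrite divfK ?lt_eqF// -opprB e mulrN opprK.
split=> //; first by rewrite -mulrNN -invrN divr_ge0// oppr_ge0// ltW.
by rewrite ler_ndivrMr// mul1r.
Qed.

Definition C1 {d : nat} (f : 'rV[R]_d -> R) : Prop :=
  [/\ forall i x, derivable f x 'e_i, continuous f &
      forall i, continuous (fun x => 'D_('e_i) f x)].

(** The coordinates of x are replaced by those of y one at a time, and the mean
    value theorem is applied to each replacement. *)
Lemma hadamard d (f : 'rV[R]_d -> R) (x y : 'rV[R]_d) : C1 f ->
  exists xi : 'I_d -> 'rV[R]_d,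
    (forall i j, `|xi i 0 j - x 0 j| <= `|y 0 j - x 0 j|) /\
    f y - f x = \sum_i 'D_('e_i) f (xi i) * (y 0 i - x 0 i).
Proof.
move=> [fd _ _].
pose p k : 'rV[R]_d := \row_j (if (j < k)%N then y 0 j else x 0 j).
have step (i : 'I_d) : exists z : 'rV[R]_d,
    (forall j, `|z 0 j - x 0 j| <= `|y 0 j - x 0 j|) /\
    f (p i.+1) - f (p i) = 'D_('e_i) f z * (y 0 i - x 0 i).
  have [t [t0 t1]] := @mvt0 (fun s => f (p i + s *: 'e_i)) _ (y 0 i - x 0 i)
    (fun s => line_derive _ f (p i) 'e_i s (fd _ _)).
  rewrite scale0r addr0 => e.
  exists (p i + (t * (y 0 i - x 0 i)) *: 'e_i); split.
    move=> j; rewrite !mxE eqxx /=.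
    have [->|ji] := eqVneq j i.
      rewrite ltnn mulr1 addrAC subrr add0r normrM ger0_norm//.
      by rewrite ler_piMl.
    by rewrite mulr0 addr0; case: ifP => // _; rewrite subrr normr0.
  rewrite -e; congr (f _ - _); apply/rowP => j; rewrite !mxE eqxx /= ltnS leq_eqVlt.
  have [/val_inj->|ji] := eqVneq (j : nat) i.
    by rewrite ltnn eqxx mulr1 addrCA subrr addr0.
  by rewrite -val_eqE /= (negbTE ji) mulr0 addr0.
have [xi xiP] := choice step.
exists xi; split; first by move=> i j; case: (xiP i).
rewrite -(eq_bigr _ (fun i _ => (xiP i).2)).
rewrite -(big_mkord xpredT (fun i => f (p i.+1) - f (p i))) telescope_sumr//.
congr (f _ - f _); apply/rowP => j; rewrite !mxE ?ltn_ord//.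
Qed.

Lemma derivable_cvg (V : normedModType R) (f : V -> R) x v :
  derivable f x v -> f (h *: v + x) @[h --> 0^'] --> f x.
Proof.
move=> fd.
have : f x + h * (h^-1 *: ((f \o shift x) (h *: v) - f x)) @[h --> 0^']
    --> f x + 0 * 'D_v f x.
  apply: cvgD; first exact: cvg_cst.
  apply: cvgM => //; exact: nbhs_dnbhs.
rewrite mul0r addr0; apply: cvg_trans; apply: near_eq_cvg; near=> h.
have h0 : h != 0 by near: h; exact: nbhs_dnbhs_neq.
by rewrite /= [h * _]mulrA mulfV// mul1r addrCA subrr addr0.
Unshelve. all: by end_near. Qed.

(** By [hadamard] the difference quotients of f o z are combinations of
    those of the coordinates of z, with coefficients that converge because the
    partial derivatives of f are continuous. *)
Lemma chain_rule (V : normedModType R) k (f : 'rV[R]_k -> R) (z : V -> 'rV[R]_k)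
    x v (dz : 'I_k -> R) : C1 f ->
  (forall j, is_derive x v (fun y => z y 0 j) (dz j)) ->
  is_derive x v (f \o z) (\sum_j 'D_('e_j) f (z x) * dz j).
Proof.
move=> fC zd.
have [xi xiP] := choice (fun h : R => hadamard _ f (z x) (z (h *: v + x)) fC).
have zc j : z (h *: v + x) 0 j @[h --> 0^'] --> z x 0 j.
  by have [zj _] := zd j; apply: (@derivable_cvg _ (fun y => z y 0 j)).
have xic j : xi h j @[h --> 0^'] --> z x.
  apply: (@continuous_row _ _ (fun h => xi h j)) => i; apply/cvgrPdist_le => /= e e0.
  near=> h; rewrite distrC (le_trans ((xiP h).1 j i))// distrC.
  near: h; exact: ((cvgrPdist_le _ _).1 (zc i) e e0).
have main : h^-1 *: ((f \o z \o shift x) (h *: v) - (f \o z) x) @[h --> 0^'] -->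
    \sum_j 'D_('e_j) f (z x) * dz j.
  rewrite (_ : (fun h => _) = fun h => \sum_j 'D_('e_j) f (xi h j) *
      (h^-1 *: (((fun y => z y 0 j) \o shift x) (h *: v) - z x 0 j))); last first.
    apply/funext => h /=; rewrite (xiP h).2 scaler_sumr; apply: eq_bigr => j _.
    by rewrite [LHS]mulrCA.
  apply: (@cvg_big _ _ +%R) => [|j _]; first exact: add_continuous.
  apply: cvgM.
    have [_ _ fc] := fC.
    exact: (cvg_comp _ _ (xic j) (fc j (z x))).
  by case: (zd j) => zj <-.
apply: DeriveDef; first by apply: cvgP main.
exact: cvg_lim main.
Unshelve. all: by end_near. Qed.

End Calculus.

Section SmoothClasses.
Context {R : realType}.

(** The closure lemmas below also give the partial derivatives as functions, since
    the class C2 requires these to be C1 again. *)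
Lemma C1P d (f : 'rV[R]_d -> R) (df : 'I_d -> 'rV[R]_d -> R) :
  continuous f -> (forall i, continuous (df i)) ->
  (forall i x, is_derive x 'e_i f (df i x)) ->
  C1 f /\ forall i, (fun x => 'D_('e_i) f x) = df i.
Proof.
move=> fc dfc fd.
have e i : (fun x => 'D_('e_i) f x) = df i.
  by apply/funext => x; case: (fd i x).
by split=> //; split=> // i; rewrite e.
Qed.

Lemma C1_derive d (f : 'rV[R]_d -> R) i x : C1 f ->
  is_derive x 'e_i f ('D_('e_i) f x).
Proof. by case=> fd _ _; exact: derivableP. Qed.

Lemma C1_cst d (c : R) : C1 (fun _ : 'rV[R]_d => c) /\
  forall i : 'I_d, (fun x => 'D_('e_i) (fun _ : 'rV[R]_d => c) x) = fun=> 0.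
Proof.
by apply: C1P => [|i]; apply: cst_continuous.
Qed.

Lemma is_derive_coord d (x v : 'rV[R]_d) j :
  is_derive x v (fun y : 'rV[R]_d => y 0 j) (v 0 j).
Proof.
have e : (fun h : R => h^-1 *: (((fun y : 'rV[R]_d => y 0 j) \o shift x) (h *: v) - x 0 j))
   @ 0^' --> v 0 j.
  apply: cvg_near_cst; near=> h.
  have h0 : h != 0 by near: h; exact: nbhs_dnbhs_neq.
  by rewrite /= !mxE addrK [_ *: _]mulrA mulVf// mul1r.
by apply: DeriveDef; [apply: cvgP e|exact: cvg_lim e].
Unshelve. all: by end_near. Qed.

Lemma C1_coord d (j : 'I_d) : C1 (fun x : 'rV[R]_d => x 0 j) /\
  forall i, (fun x => 'D_('e_i) (fun x : 'rV[R]_d => x 0 j) x) = fun=> ((i == j)%:R : R).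
Proof.
apply: C1P => [|i|i x]; [exact: coord_continuous|exact: cst_continuous|].
by have := is_derive_coord d x 'e_i j; rewrite mxE eqxx eq_sym.
Qed.

Lemma continuous_mulr (T : topologicalType) (f g : T -> R) :
  continuous f -> continuous g -> continuous (fun x => f x * g x).
Proof. by move=> fc gc x; apply: continuousM; [exact: fc|exact: gc]. Qed.

Lemma continuous_addr (T : topologicalType) (f g : T -> R) :
  continuous f -> continuous g -> continuous (fun x => f x + g x).
Proof. by move=> fc gc x; apply: continuousD; [exact: fc|exact: gc]. Qed.

Lemma continuous_compr (T U V : topologicalType) (f : U -> V) (z : T -> U) :
  continuous f -> continuous z -> continuous (f \o z).
Proof. by move=> fc zc x; apply: continuous_comp; [exact: zc|exact: fc]. Qed.

Lemma C1_mul d (f g : 'rV[R]_d -> R) : C1 f -> C1 g ->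
  C1 (fun x => f x * g x) /\
  forall i, (fun x => 'D_('e_i) (fun x => f x * g x) x) =
    fun x => 'D_('e_i) f x * g x + f x * 'D_('e_i) g x.
Proof.
move=> fC gC; have [fd fc fdc] := fC; have [gd gc gdc] := gC.
apply: C1P => [|i|i x].
- exact: continuous_mulr.
- by apply: continuous_addr; apply: continuous_mulr.
- have H := @is_deriveM _ _ f g x 'e_i _ _ (C1_derive _ f i x fC) (C1_derive _ g i x gC).
  rewrite (_ : _ + _ = f x *: 'D_('e_i) g x + g x *: 'D_('e_i) f x); first exact: H.
  by rewrite addrC; congr (_ + _); rewrite mulrC.
Qed.

Lemma continuous_sumr (T : topologicalType) (I : Type) (r : seq I) (F : I -> T -> R) :
  (forall i, continuous (F i)) -> continuous (fun x => \sum_(i <- r) F i x).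
Proof. by move=> Fc; apply: continuous_big => //; exact: add_continuous. Qed.

Lemma C1_sum d k (F : 'I_k -> 'rV[R]_d -> R) : (forall j, C1 (F j)) ->
  C1 (fun x => \sum_j F j x) /\
  forall i, (fun x => 'D_('e_i) (fun x => \sum_j F j x) x) =
    fun x => \sum_j 'D_('e_i) (F j) x.
Proof.
move=> FC; apply: C1P => [|i|i x].
- by apply: continuous_sumr => j; case: (FC j).
- by apply: continuous_sumr => j; case: (FC j).
- have := @is_derive_sum _ _ _ k F x 'e_i (fun j => 'D_('e_i) (F j) x)
    (fun j => C1_derive _ (F j) i x (FC j)).
  by congr (is_derive _ _ _ _); apply/funext => y; rewrite fct_sumE.
Qed.

Lemma C1_comp d k (f : 'rV[R]_k -> R) (z : 'rV[R]_d -> 'rV[R]_k) : C1 f ->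
  (forall j, C1 (fun x => z x 0 j)) ->
  C1 (f \o z) /\ forall i, (fun x => 'D_('e_i) (f \o z) x) =
    fun x => \sum_j 'D_('e_j) f (z x) * 'D_('e_i) (fun x => z x 0 j) x.
Proof.
move=> fC zC; have [fd fc fdc] := fC.
have zc : continuous z.
  move=> x; apply: (@continuous_row R _ k z (nbhs x) (z x) (nbhs_filter x)) => j.
  by have [_ zjc _] := zC j; exact: zjc.
apply: C1P => [|i|i x].
- exact: continuous_compr.
- apply: continuous_sumr => j; apply: continuous_mulr.
    exact: (continuous_compr _ _ _ _ z (fdc j) zc).
  by have [_ _] := zC j; exact.
- by apply: chain_rule => // j; exact: C1_derive.
Qed.

Definition C2 {d : nat} (f : 'rV[R]_d -> R) : Prop :=
  C1 f /\ forall i, C1 (fun x => 'D_('e_i) f x).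

Lemma isC2P d (f : 'rV[R]_d -> R) : isC2 f -> C2 f.
Proof.
move=> [fd fc]; split.
  split=> [i x||i]; [exact: (fd [::])|exact: (fc [::])|exact: (fc [:: i])].
move=> j; split=> [i x||i]; [exact: (fd [:: j])|exact: (fc [:: j])|].
exact: (fc [:: i; j]).
Qed.

Lemma C2_comp d k (f : 'rV[R]_k -> R) (z : 'rV[R]_d -> 'rV[R]_k) : C2 f ->
  (forall j, C2 (fun x => z x 0 j)) -> C2 (f \o z).
Proof.
move=> [fC fdC] zC; have [fzC fzD] := C1_comp _ _ _ _ fC (fun j => (zC j).1).
split=> [|i]; [exact: fzC|rewrite fzD].
apply: (C1_sum _ _ _ _).1 => j; apply: (C1_mul _ _ _ _ _).1; last exact: (zC j).2.
by have [H _] := C1_comp _ _ _ z (fdC j) (fun l => (zC l).1); exact: H.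
Qed.

Lemma C2_cst d (c : R) : C2 (fun _ : 'rV[R]_d => c).
Proof.
have [H e] := C1_cst d c; split=> [|i]; [exact: H|rewrite e]; exact: (C1_cst d 0).1.
Qed.

Lemma C2_coord d (j : 'I_d) : C2 (fun x : 'rV[R]_d => x 0 j).
Proof.
have [H e] := C1_coord d j; split=> [|i]; [exact: H|rewrite e]; exact: (C1_cst d _).1.
Qed.

Lemma C2_sum d k (F : 'I_k -> 'rV[R]_d -> R) : (forall j, C2 (F j)) ->
  C2 (fun x => \sum_j F j x).
Proof.
move=> FC; have [H e] := C1_sum d k F (fun j => (FC j).1).
split=> [|i]; [exact: H|rewrite e]; apply: (C1_sum _ _ _ _).1 => j; exact: (FC j).2.
Qed.

Lemma C2_add d (f g : 'rV[R]_d -> R) : C2 f -> C2 g -> C2 (fun x => f x + g x).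
Proof.
move=> fC gC.
rewrite (_ : (fun x => _) = fun x => \sum_(j < 2) (if j == ord0 then f else g) x).
  by apply: C2_sum => j; case: ifP.
by apply/funext => x; rewrite !big_ord_recl big_ord0 addr0.
Qed.

Lemma C2_scale d (c : R) (f : 'rV[R]_d -> R) : C2 f -> C2 (fun x => c * f x).
Proof.
move=> [fC fdC].
have sc (g : 'rV[R]_d -> R) : C1 g -> C1 (fun x => c * g x) /\
    forall i, (fun x => 'D_('e_i) (fun x => c * g x) x) = fun x => c * 'D_('e_i) g x.
  move=> gC; have [cC ce] := C1_cst d c.
  have [H e] := C1_mul _ (fun=> c) g cC gC; split=> [|i]; [exact: H|rewrite e].
  by apply/funext => x; rewrite (congr1 (@^~ x) (ce i)) mul0r add0r.
have [H e] := sc f fC; split=> [|i]; [exact: H|rewrite e]; exact: (sc _ (fdC i)).1.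
Qed.

(** By induction on the layers, as each node value is the composite of a node
    with the values of its predecessors. *)
Lemma cf_eval1_C2 d (F : compfun R d 1) : all_nodes_C2 F -> C2 (cf_eval1 F).
Proof.
move=> FC.
have val k : forall v : cf_node F, (cf_layer v <= k)%N ->
    C2 (fun x => @cf_val _ _ _ F x v).
  elim: k => [v|k IH v].
    rewrite leqn0 -cf_in_codom => /codomP[i ->].
    rewrite (_ : (fun x => _) = fun x : 'rV[R]_d => x 0 i); first exact: C2_coord.
    apply/funext => x; rewrite /cf_val cf_truncE1; last first.
      by rewrite leqn0 -cf_in_codom codom_f.
    rewrite /cf_assign; case: pickP => [i'|/(_ i)]; last by rewrite eqxx.
    by move=> /eqP /cf_in_inj ->.
  rewrite leq_eqVlt => /orP[/eqP vk|]; last by rewrite ltnS; exact: IH.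
  rewrite (_ : (fun x => _) = @cf_fun _ _ _ F v \o
      fun x => \row_(i < size (cf_preds v))
          @cf_val _ _ _ F x (tnth (in_tuple (cf_preds v)) i)); last first.
    by apply/funext => x; rewrite /cf_val cf_truncE2 ?vk.
  apply: C2_comp => [|j]; first by apply/isC2P/FC; rewrite /is_input vk.
  rewrite (_ : (fun x => _) =
     fun x => @cf_val _ _ _ F x (tnth (in_tuple (cf_preds v)) j)); last first.
    by apply/funext => x; rewrite mxE.
  by apply: IH; rewrite -ltnS -vk; apply: cf_edge_layer; exact: mem_tnth.
rewrite (_ : cf_eval1 F = fun x => @cf_val _ _ _ F x (cf_out F 0)).
  exact/val/cf_layer_max.
by apply/funext => x; rewrite /cf_eval1 mxE.
Qed.

Lemma second_difference d (f : 'rV[R]_d -> R) i j (x : 'rV[R]_d) (h : R) :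
  C2 f -> 0 <= h ->
  exists y : 'rV[R]_d, (forall k, `|y 0 k - x 0 k| <= h + h) /\
    f (x + h *: 'e_i + h *: 'e_j) - f (x + h *: 'e_i) - f (x + h *: 'e_j) + f x
    = 'D_('e_j) (fun x => 'D_('e_i) f x) y * h * h.
Proof.
move=> [[fd _ _] fdC] h0; have [fdd _ _] := fdC i.
have [s [s0 s1]] := @mvt0 _ (fun s => f ((x + h *: 'e_j) + s *: 'e_i) - f (x + s *: 'e_i))
   (fun s => 'D_('e_i) f ((x + h *: 'e_j) + s *: 'e_i) - 'D_('e_i) f (x + s *: 'e_i)) h
   (fun s => is_deriveB (line_derive _ _ _ _ _ (fd i _))
     (line_derive _ _ _ _ _ (fd i _))).
have [t [t0 t1]] := @mvt0 _ (fun t => 'D_('e_i) f ((x + (s * h) *: 'e_i) + t *: 'e_j)) _ h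
   (fun t => line_derive _ _ _ _ _ (fdd j _)).
rewrite !scale0r !addr0 => e1 e2.
exists ((x + (s * h) *: 'e_i) + (t * h) *: 'e_j); split.
  move=> k; rewrite !mxE eqxx /= -addrA addrAC subrr add0r.
  have b (a : R) (c : bool) : 0 <= a -> a <= 1 -> `|a * h * c%:R| <= h.
    move=> a0 a1; case: c; last by rewrite mulr0 normr0.
    by rewrite mulr1 normrM !ger0_norm// ler_piMl.
  by rewrite (le_trans (ler_normD _ _))// lerD// b.
rewrite -e1 [x + (s * h) *: _ + _]addrAC -e2 [x + h *: 'e_i + _]addrAC; ring.
Qed.

(** Both second partial derivatives are limits of the same second difference,
    which is symmetric in i and j. *)
Lemma clairaut d (f : 'rV[R]_d -> R) i j x : C2 f ->
  'D_('e_i) (fun x => 'D_('e_j) f x) x = 'D_('e_j) (fun x => 'D_('e_i) f x) x.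
Proof.
move=> fC2; have [fC fdC] := fC2.
have fcont a b : continuous (fun x => 'D_('e_a) (fun x => 'D_('e_b) f x) x).
  by have [_ _] := fdC b; exact.
have [y yP] := choice (fun h : R => second_difference _ f i j x `|h| fC2 (normr_ge0 h)).
have [z zP] := choice (fun h : R => second_difference _ f j i x `|h| fC2 (normr_ge0 h)).
have lim (w : R -> 'rV[R]_d) a b : (forall h k, `|w h 0 k - x 0 k| <= `|h| + `|h|) ->
   'D_('e_a) (fun x => 'D_('e_b) f x) (w h) @[h --> 0^'] -->
   'D_('e_a) (fun x => 'D_('e_b) f x) x.
  move=> wP; suff wx : w h @[h --> (0 : R)^'] --> x.
    exact: (cvg_comp _ _ wx (fcont a b x)).
  apply: (@continuous_row R R d w (0 : R)^' x _) => k.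
  apply/cvgrPdist_le => /= e e0.
  near=> h; rewrite distrC (le_trans (wP h k))// [leRHS]splitr lerD//;
  by near: h; apply: dnbhs0_le; rewrite divr_gt0.
have yl := lim y j i (fun h => (yP h).1).
have zl := lim z i j (fun h => (zP h).1).
suff zl' : 'D_('e_i) (fun x => 'D_('e_j) f x) (z h) @[h --> 0^'] -->
    'D_('e_j) (fun x => 'D_('e_i) f x) x by exact: (norm_cvg_unique zl zl').
apply: cvg_trans yl; apply: near_eq_cvg; near=> h.
have cancel (a b c : R) : c != 0 -> a * c * c = b * c * c -> a = b.
  by move=> c0 /(mulIf c0)/(mulIf c0).
have h0 : `|h| != 0 by rewrite normr_eq0; near: h; exact: nbhs_dnbhs_neq.
have S : f (x + `|h| *: 'e_i + `|h| *: 'e_j) - f (x + `|h| *: 'e_i) -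
      f (x + `|h| *: 'e_j) + f x =
    f (x + `|h| *: 'e_j + `|h| *: 'e_i) - f (x + `|h| *: 'e_j) -
      f (x + `|h| *: 'e_i) + f x.
  by rewrite [x + _ + _]addrAC; ring.
exact: (cancel _ _ _ h0 (etrans (esym (yP h).2) (etrans S (zP h).2))).
Unshelve. all: by end_near. Qed.

End SmoothClasses.

(** * Euclidean geometry and quadratic forms *)

Section Euclid.
Context {R : realType}.

Definition dotp {d : nat} (u v : 'rV[R]_d) : R := \sum_i u 0 i * v 0 i.

Lemma dotpC d (u v : 'rV[R]_d) : dotp u v = dotp v u.
Proof. by apply: eq_bigr => i _; rewrite mulrC. Qed.

Lemma dotpDl d (u v w : 'rV[R]_d) : dotp (u + v) w = dotp u w + dotp v w.
Proof. by rewrite -big_split; apply: eq_bigr => i _; rewrite mxE mulrDl. Qed.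

Lemma dotpZl d c (u w : 'rV[R]_d) : dotp (c *: u) w = c * dotp u w.
Proof. by rewrite mulr_sumr; apply: eq_bigr => i _; rewrite mxE mulrA. Qed.

Lemma dotpDr d (u v w : 'rV[R]_d) : dotp w (u + v) = dotp w u + dotp w v.
Proof. by rewrite dotpC dotpDl !(dotpC _ w). Qed.

Lemma dotpZr d c (u w : 'rV[R]_d) : dotp w (c *: u) = c * dotp w u.
Proof. by rewrite dotpC dotpZl dotpC. Qed.

Lemma dotpNl d (u w : 'rV[R]_d) : dotp (- u) w = - dotp u w.
Proof. by rewrite -scaleN1r dotpZl mulN1r. Qed.

Lemma dotpNr d (u w : 'rV[R]_d) : dotp w (- u) = - dotp w u.
Proof. by rewrite dotpC dotpNl dotpC. Qed.

Lemma dotp0l d (w : 'rV[R]_d) : dotp 0 w = 0.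
Proof. by rewrite /dotp big1// => i _; rewrite mxE mul0r. Qed.

Lemma dotp0r d (w : 'rV[R]_d) : dotp w 0 = 0.
Proof. by rewrite dotpC dotp0l. Qed.

Lemma dotp_delta d (u : 'rV[R]_d) i : dotp u 'e_i = u 0 i.
Proof.
rewrite /dotp (bigD1 i)//= mxE !eqxx mulr1 big1 ?addr0// => j ji.
by rewrite mxE (negbTE ji) andbF mulr0.
Qed.

Lemma dotp_ge0 d (u : 'rV[R]_d) : 0 <= dotp u u.
Proof. by apply: sumr_ge0 => i _; rewrite -expr2 sqr_ge0. Qed.

Lemma enorm_ge0 d (u : 'rV[R]_d) : 0 <= enorm u.
Proof. exact: sqrtr_ge0. Qed.

Lemma enormE d (u : 'rV[R]_d) : enorm u = Num.sqrt (dotp u u).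
Proof. by congr Num.sqrt; apply: eq_bigr => i _; rewrite expr2. Qed.

Lemma enorm0 d : enorm (0 : 'rV[R]_d) = 0.
Proof. by rewrite enormE dotp0l sqrtr0. Qed.

Lemma sqr_enorm d (u : 'rV[R]_d) : enorm u ^+ 2 = dotp u u.
Proof. by rewrite enormE sqr_sqrtr// dotp_ge0. Qed.

Lemma enorm_eq0 d (u : 'rV[R]_d) : enorm u = 0 -> u = 0.
Proof.
move=> u0; have := sqr_enorm _ u; rewrite u0 expr0n /= => /esym/eqP.
rewrite psumr_eq0 => [/allP H|i _]; last by rewrite -expr2 sqr_ge0.
apply/rowP => i; rewrite mxE; apply/eqP; rewrite -sqrf_eq0 expr2.
by apply: H; rewrite mem_index_enum.
Qed.

Lemma enormZ d c (u : 'rV[R]_d) : enorm (c *: u) = `|c| * enorm u.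
Proof.
by rewrite !enormE dotpZl dotpZr mulrA -expr2 sqrtrM ?sqr_ge0// sqrtr_sqr.
Qed.

Lemma enormN d (u : 'rV[R]_d) : enorm (- u) = enorm u.
Proof. by rewrite -scaleN1r enormZ normrN1 mul1r. Qed.

Lemma cauchy_schwarz d (u v : 'rV[R]_d) : dotp u v <= enorm u * enorm v.
Proof.
set a := enorm u; set b := enorm v.
have [a0 b0] : 0 <= a /\ 0 <= b by rewrite !enorm_ge0.
have := dotp_ge0 _ (b *: u - a *: v).
rewrite dotpDl !dotpDr dotpNl !dotpNr dotpNl !dotpZl !dotpZr (dotpC _ v u).
rewrite -!sqr_enorm -/a -/b => H.
have [ab|] := ltP 0 (a * b); last first.
  move=> ab; have /eqP : a * b = 0 by apply/eqP; rewrite eq_le ab mulr_ge0.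
  rewrite mulf_eq0 => /orP[] /eqP /enorm_eq0 ->.
    by rewrite dotp0l mulr_ge0.
  by rewrite dotp0r mulr_ge0.
rewrite -(ler_pM2l ab); nra.
Qed.

Lemma enorm_triangle d (u v : 'rV[R]_d) : enorm (u + v) <= enorm u + enorm v.
Proof.
rewrite -(@ler_pXn2r _ 2)// ?nnegrE ?enorm_ge0 ?addr_ge0 ?enorm_ge0//.
rewrite sqr_enorm dotpDl !dotpDr (dotpC _ v u) sqrrD !sqr_enorm.
have := cauchy_schwarz _ u v; lra.
Qed.

Lemma enorm_coord d (u : 'rV[R]_d) i : `|u 0 i| <= enorm u.
Proof.
rewrite -sqrtr_sqr enormE ler_wsqrtr// /dotp (bigD1 i)//= expr2 lerDl.
by apply: sumr_ge0 => j _; rewrite -expr2 sqr_ge0.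
Qed.

Lemma enorm_le d (u : 'rV[R]_d) b : 0 <= b -> (forall i, `|u 0 i| <= b) ->
  enorm u <= d%:R * b.
Proof.
move=> b0 ub.
rewrite -(@ler_pXn2r _ 2)// ?nnegrE ?enorm_ge0 ?mulr_ge0//.
rewrite sqr_enorm.
case: d u ub => [u _|d u ub]; first by rewrite /dotp big_ord0 mul0r expr0n.
apply: (@le_trans _ _ (d.+1%:R * b ^+ 2)).
  have -> : d.+1%:R * b ^+ 2 = \sum_(i < d.+1) b ^+ 2.
    by rewrite sumr_const card_ord mulr_natl.
  apply: ler_sum => i _; rewrite -expr2.
  by rewrite -real_normK ?num_real// ler_sqr ?nnegrE.
by rewrite exprMn ler_wpM2r ?sqr_ge0// expr2 ler_peMl// ler1n.
Qed.

Lemma eball_convex d (c x y : 'rV[R]_d) r t : 0 <= t -> t <= 1 ->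
  eball c r x -> eball c r y -> eball c r (x + t *: (y - x)).
Proof.
rewrite /eball /= => t0 t1 xr yr.
rewrite (_ : _ - c = (1 - t) *: (x - c) + t *: (y - c)); last first.
  by apply/rowP => i; rewrite !mxE; ring.
rewrite (le_trans (enorm_triangle _ _ _))// !enormZ !ger0_norm ?subr_ge0//.
have := ler_wpM2l t0 yr; have : 0 <= 1 - t by lra.
by move=> /ler_wpM2l /(_ _ _ xr); lra.
Qed.

Lemma qformE d (H : 'M[R]_d) v : qform H v = dotp (v *m H) v.
Proof. by rewrite /qform mxE; apply: eq_bigr => i _; rewrite [v^T _ _]mxE. Qed.

Lemma form_sym d (H : 'M[R]_d) u v : H^T = H -> dotp (u *m H) v = dotp (v *m H) u.
Proof.
move=> Hs; have E a b : dotp a b = (a *m b^T) 0 0.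
  by rewrite mxE; apply: eq_bigr => i _; rewrite [b^T _ _]mxE.
rewrite !E; have -> : u *m H *m v^T = (v *m H *m u^T)^T.
  by rewrite !trmx_mul trmxK Hs mulmxA.
by rewrite mxE.
Qed.

(** Cauchy-Schwarz for a bounded positive symmetric form, by polarization. *)
Lemma form_bound d (H : 'M[R]_d) (M : R) u w : H^T = H ->
  (forall v, 0 <= qform H v <= M * dotp v v) ->
  dotp (u *m H) w <= M * (enorm u * enorm w).
Proof.
move=> Hs HM; set a := enorm u; set b := enorm w.
have [a0 b0] : 0 <= a /\ 0 <= b by rewrite !enorm_ge0.
have [ab|] := ltP 0 (a * b); last first.
  move=> ab; have /eqP ab0 : a * b == 0 by rewrite eq_le ab mulr_ge0.
  rewrite ab0 mulr0; move/eqP: ab0; rewrite mulf_eq0 => /orP[] /eqP /enorm_eq0 ->.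
    by rewrite mul0mx dotp0l.
  by rewrite dotp0r.
have /andP[_ q1] := HM (b *: u + a *: w); have /andP[q2 _] := HM (b *: u - a *: w).
rewrite -(ler_pM2l ab).
have M0 : 0 <= M.
  have /andP[m1 m2] := HM u; have := le_trans m1 m2.
  rewrite -sqr_enorm pmulr_lge0// exprn_gt0// lt_neqAle a0 andbT.
  by apply/eqP => a00; move: ab; rewrite /a -a00 mul0r ltxx.
have n : dotp (b *: u + a *: w) (b *: u + a *: w) <= 4 * (a * b) ^+ 2.
  rewrite -sqr_enorm (_ : 4 * _ = (2 * (a * b)) ^+ 2); last by ring.
  rewrite ler_sqr ?nnegrE ?enorm_ge0 ?mulr_ge0//.
  rewrite (le_trans (enorm_triangle _ _ _))// !enormZ !ger0_norm// -/a -/b; lra.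
have := ler_wpM2l M0 n.
move: q1 q2; rewrite !qformE !(mulmxDl, mulNmx, =^~ scalemxAl).
rewrite !(dotpDl, dotpDr, dotpNl, dotpNr, dotpZl, dotpZr) (form_sym _ _ w u Hs) => *.
nra.
Qed.

End Euclid.

(** * The gradient method *)

Section Descent.
Context {R : realType}.

Definition grad {d : nat} (f : 'rV[R]_d -> R) (x : 'rV[R]_d) : 'rV[R]_d :=
  \row_i 'D_('e_i) f x.

Lemma line_coord d (y w : 'rV[R]_d) (t : R) j :
  is_derive t 1 (fun s : R => (y + s *: w) 0 j) (w 0 j).
Proof.
have [yd _] := is_derive_coord d (y + t *: w) w j.
have := line_derive _ (fun x : 'rV[R]_d => x 0 j) y w t yd.
by have [_ ->] := is_derive_coord d (y + t *: w) w j.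
Qed.

Lemma grad_line d (f : 'rV[R]_d -> R) (y w : 'rV[R]_d) (t : R) : C1 f ->
  is_derive t 1 (fun s : R => f (y + s *: w)) (dotp (grad f (y + t *: w)) w).
Proof.
move=> fC.
have := chain_rule R d f (fun s : R => y + s *: w) t 1 _ fC (fun j => line_coord d y w t j).
by congr (is_derive _ _ _ _); apply: eq_bigr => i _; rewrite mxE.
Qed.

Lemma hess_line d (f : 'rV[R]_d -> R) (y w v : 'rV[R]_d) (t : R) : C2 f ->
  is_derive t 1 (fun s : R => dotp (grad f (y + s *: w)) v)
    (dotp (w *m hessian f (y + t *: w)) v).
Proof.
move=> [_ fdC].
have dD i := grad_line d _ y w t (fdC i).
have H := @is_derive_sum R R R d (fun i (s : R) => v 0 i * 'D_('e_i) f (y + s *: w)) t 1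
  _ (fun i => is_deriveZ (v 0 i) (dD i)).
rewrite (_ : (fun s => _) =
  \sum_i (fun s : R => v 0 i * 'D_('e_i) f (y + s *: w))); last first.
  by apply/funext => s; rewrite fct_sumE; apply: eq_bigr => i _; rewrite mxE mulrC.
rewrite (_ : dotp _ v =
  \sum_i v 0 i *: dotp (grad (fun x => 'D_('e_i) f x) (y + t *: w)) w).
  exact: H.
apply: eq_bigr => i _; rewrite mulrC; congr (_ * _).
by rewrite dotpC mxE; apply: eq_bigr => j _; rewrite !mxE.
Qed.

Lemma hessian_sym d (f : 'rV[R]_d -> R) x : C2 f -> (hessian f x)^T = hessian f x.
Proof. by move=> fC; apply/matrixP => i j; rewrite !mxE /=; exact: clairaut. Qed.

(** The point t depends on v: this is the mean value theorem for one component of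
    the gradient at a time. *)
Lemma grad_mvt d (f : 'rV[R]_d -> R) (x y v : 'rV[R]_d) : C2 f ->
  exists t, [/\ 0 <= t, t <= 1 &
    dotp (grad f y - grad f x) v = dotp ((y - x) *m hessian f (x + t *: (y - x))) v].
Proof.
move=> fC; have [t [t0 t1]] := @mvt0 R _ _ 1 (fun t => hess_line d f x (y - x) v t fC).
rewrite scale0r addr0 scale1r addrCA subrr addr0 !mulr1 => e.
by exists t; split=> //; rewrite dotpDl dotpNl.
Qed.

Lemma sqr_enorm_subZ d (u v : 'rV[R]_d) k :
  enorm (u - k *: v) ^+ 2 =
  enorm u ^+ 2 - 2 * (k * dotp v u) + k * (k * enorm v ^+ 2).
Proof.
rewrite sqr_enorm !(dotpDl, dotpDr, dotpNl, dotpNr, dotpZl, dotpZr).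
by rewrite -!sqr_enorm (dotpC _ u v); ring.
Qed.

Section OnBall.
Context {p : nat}.
Variables (f : 'rV[R]_p -> R) (c : 'rV[R]_p) (r mu M : R).
Hypotheses (fC : C2 f) (mu0 : 0 < mu) (muM : mu <= M).
Hypothesis fH : forall x v, eball c r x ->
  mu * dotp v v <= qform (hessian f x) v <= M * dotp v v.

(** With d = x - y, strong monotonicity and Lipschitz continuity of the gradient
    bound |d - h grad f x|^2 by (1 - 2 h mu + h^2 M^2) |d|^2; the factor is least
    for h = mu / M^2. *)
Lemma gradient_step x y : eball c r x -> eball c r y -> grad f y = 0 ->
  enorm (x - (mu / M ^+ 2) *: grad f x - y) <=
    (1 - mu ^+ 2 / (2 * M ^+ 2)) * enorm (x - y).
Proof.
move=> xB yB gy; set g := grad f x; set d := x - y; set e := enorm d.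
have M0 : 0 < M by exact: lt_le_trans muM.
have e0 : 0 <= e := enorm_ge0 _ _.
have mono : mu * e ^+ 2 <= dotp g d.
  have [t [t0 t1]] := grad_mvt p f y x d fC; rewrite gy subr0 -/g -/d => ->.
  rewrite -qformE sqr_enorm.
  by have /andP[] := fH (y + t *: d) d (eball_convex _ _ _ _ _ _ t0 t1 yB xB).
have lip : enorm g <= M * e.
  have [t [t0 t1]] := grad_mvt p f y x g fC; rewrite gy subr0 -/g -/d => gg.
  have zB := eball_convex _ _ _ _ _ _ t0 t1 yB xB.
  have := form_bound _ (hessian f (y + t *: d)) M d g (hessian_sym _ _ _ fC).
  rewrite -gg -sqr_enorm -/e mulrA expr2 => H.
  have {}H : enorm g * enorm g <= M * e * enorm g.
    apply: H => v; have /andP[h1 ->] := fH _ v zB; rewrite andbT.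
    by rewrite (le_trans _ h1)// mulr_ge0 ?dotp_ge0// ltW.
  have := enorm_ge0 _ g; rewrite le_eqVlt => /orP[/eqP <-|g0].
    by rewrite mulr_ge0// ltW.
  by rewrite -(ler_pM2r g0).
have g0 := enorm_ge0 _ g.
set k := mu / M.
have k0 : 0 < k by rewrite divr_gt0.
have k1 : k <= 1 by rewrite ler_pdivrMr// mul1r.
have -> : mu / M ^+ 2 = k / M by rewrite expr2 invfM mulrA.
have -> : mu ^+ 2 / (2 * M ^+ 2) = k ^+ 2 / 2.
  by rewrite /k; field; rewrite gt_eqF.
have kk : k ^+ 2 <= 1 by rewrite expr_le1// ltW.
rewrite -(@ler_pXn2r _ 2)// ?nnegrE ?enorm_ge0 ?mulr_ge0//; last by lra.
rewrite (_ : x - _ - y = d - (k / M) *: g); last by rewrite addrAC.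
rewrite sqr_enorm_subZ -/e exprMn.
have h1 : k ^+ 2 * e ^+ 2 <= k / M * dotp g d.
  have -> : k ^+ 2 * e ^+ 2 = k / M * (mu * e ^+ 2).
    by rewrite /k; field; rewrite gt_eqF.
  by rewrite ler_wpM2l// divr_ge0// ltW.
have h2 : k / M * (k / M * enorm g ^+ 2) <= k ^+ 2 * e ^+ 2.
  have -> : k ^+ 2 * e ^+ 2 = k / M * (k / M * (M * e) ^+ 2).
    by rewrite /k; field; rewrite gt_eqF.
  have kM : 0 <= k / M by rewrite divr_ge0// ltW.
  do 2!apply: ler_wpM2l => //.
  by rewrite ler_pXn2r// nnegrE// mulr_ge0// ltW.
have h3 : 0 <= (k ^+ 2) ^+ 2 / 4 * e ^+ 2.
  by rewrite mulr_ge0 ?sqr_ge0// divr_ge0// sqr_ge0.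
by rewrite /= in h1 h2 h3 *; lra.
Qed.

(** The term M t is the error of the exact quotient, as the second derivative
    along 'e_i lies in [0, M]; the term 2 delta / t comes from the values a and b,
    which are only known up to delta. *)
Lemma forward_difference x i t delta (a b : R) : 0 < t ->
  eball c r x -> eball c r (x + t *: 'e_i) ->
  `|a - f (x + t *: 'e_i)| <= delta -> `|b - f x| <= delta ->
  `|(a - b) / t - grad f x 0 i| <= M * t + 2 * delta / t.
Proof.
move=> t0 xB xtB aP bP.
have seg s : 0 <= s -> s <= t -> eball c r (x + s *: 'e_i).
  move=> s0 st.
  have := eball_convex _ c _ _ _ (s / t) _ _ xB xtB.
  rewrite addrAC subrr add0r scalerA divfK ?gt_eqF//; apply.
    by rewrite divr_ge0// ltW.
  by rewrite ler_pdivrMr// mul1r.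
have [fC1 fdC] := fC.
have [s [s0 s1]] := @mvt0 R _ _ t (fun s => grad_line p f x 'e_i s fC1).
rewrite scale0r addr0 dotp_delta => e1.
have [u [u0 u1]] := @mvt0 R _ _ (s * t) (fun s => hess_line p f x 'e_i 'e_i s fC).
rewrite scale0r addr0 !dotp_delta => e2.
have st0 : 0 <= s * t by rewrite mulr_ge0// ltW.
have stt : s * t <= t by rewrite ler_piMl// ltW.
have B : eball c r (x + (u * (s * t)) *: 'e_i).
  by apply: seg; [rewrite mulr_ge0|rewrite (le_trans _ stt)// ler_piMl].
have /andP[q1 q2] := fH _ 'e_i B.
have ee : dotp 'e_i 'e_i = 1 :> R by rewrite dotp_delta mxE !eqxx.
rewrite ee qformE dotp_delta !mulr1 in q1 q2.
have g : `|grad f (x + (s * t) *: 'e_i) 0 i - grad f x 0 i| <= M * t.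
  rewrite e2 ger0_norm; last by rewrite mulr_ge0// (le_trans _ q1)// ltW.
  by apply: ler_pM => //; rewrite (le_trans _ q1)// ltW.
have -> : (a - b) / t - grad f x 0 i =
   (grad f (x + (s * t) *: 'e_i) 0 i - grad f x 0 i) +
   ((a - f (x + t *: 'e_i)) - (b - f x)) / t.
  have -> : a - f (x + t *: 'e_i) - (b - f x) = a - b - (f (x + t *: 'e_i) - f x).
    by ring.
  by rewrite e1 [in RHS]mulrBl mulfK ?gt_eqF//; ring.
rewrite (le_trans (ler_normD _ _))// lerD// normrM normfV (gtr0_norm t0).
rewrite ler_wpM2r ?invr_ge0 ?(ltW t0)//.
by rewrite (le_trans (ler_normB _ _))//; lra.
Qed.

End OnBall.

Lemma grad_min d (f : 'rV[R]_d -> R) x : C1 f -> (forall y, f x <= f y) ->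
  grad f x = 0.
Proof.
move=> fC fmin; apply/rowP => i; rewrite !mxE.
have D (t : R) := line_derive _ f x 'e_i t ((C1_derive _ f i _ fC).(ex_derive)).
have [||||_ <-] := @derive1_at_min R (fun s => f (x + s *: 'e_i)) (-1) 1 0.
- by rewrite (le_trans (lerN10 _))// ler01.
- by move=> t _; case: (D t).
- by rewrite in_itv /= ltrN10 ltr01.
- by move=> t _; rewrite scale0r addr0.
by have [_] := D 0; rewrite scale0r addr0.
Qed.

End Descent.

(** * Curvature of the cost *)

Section Controls.
Context {R : realType} (N q : nat).
Implicit Types U v : 'rV[R]_(N * q).

Lemma controlE U (i : 'I_N) l : control U i 0 l = U 0 (mxvec_index i l).
Proof. by rewrite /control valK !mxE. Qed.

Lemma control_out U k : (N <= k)%N -> control U k = 0.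
Proof. by move=> Nk; rewrite /control insubF// ltnNge Nk. Qed.

Lemma dotp_control v : dotp v v = \sum_(k < N) dotp (control v k) (control v k).
Proof.
rewrite /dotp (reindex _ (curry_mxvec_bij N q)) /=.
transitivity (\sum_(i < N) \sum_(l < q)
    v 0 (mxvec_index i l) * v 0 (mxvec_index i l)).
  by rewrite pair_bigA; apply: eq_bigr => -[i l].
by apply: eq_bigr => i _; apply: eq_bigr => l _; rewrite controlE.
Qed.

Lemma control_line U v s k : control (U + s *: v) k = control U k + s *: control v k.
Proof.
have [kN|/control_out e] := ltnP k N; last by rewrite !e scaler0 addr0.
by apply/rowP => l; rewrite !mxE -[k]/(val (Ordinal kN)) !controlE !mxE.
Qed.

Lemma cube_control (rho : R) U k : cube rho U -> 0 <= rho -> cube rho (control U k).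
Proof.
move=> Uc rho0 l; have [kN|/control_out ->] := ltnP k N; last by rewrite mxE normr0.
by rewrite -[k]/(val (Ordinal kN)) controlE.
Qed.

Lemma enorm_control v k : enorm (control v k) <= enorm v.
Proof.
have [kN|/control_out ->] := ltnP k N; last first.
  by rewrite enorm0 enorm_ge0.
rewrite !enormE ler_wsqrtr// dotp_control (bigD1 (Ordinal kN))//= lerDl.
by apply: sumr_ge0 => i _; exact: dotp_ge0.
Qed.

End Controls.

Section Trajectories.
Context {R : realType} (n q N : nat) (A : 'M[R]_n) (B : 'M[R]_(n, q)).
Local Notation f := (lin_dyn A B).
Implicit Types (x : 'rV[R]_n) (U v : 'rV[R]_(N * q)).

Lemma state_line x U v s k :
  state f x (U + s *: v) k = state f x U k + s *: state f 0 v k.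
Proof.
elim: k => [|k IH] /=; first by rewrite scaler0 addr0.
rewrite IH control_line /lin_dyn !mulmxDl -!scalemxAl scalerDr.
by rewrite -!addrA; congr (_ + _); rewrite addrCA.
Qed.

Lemma enorm_mulmx d e (u : 'rV[R]_d) (C : 'M[R]_(d, e)) :
  enorm (u *m C) <= (e%:R * \sum_i \sum_j `|C i j|) * enorm u.
Proof.
rewrite -mulrA; apply: enorm_le => [|j].
  by rewrite mulr_ge0 ?enorm_ge0// sumr_ge0// => i _; rewrite sumr_ge0.
rewrite mxE (le_trans (ler_norm_sum _ _ _))// mulr_suml ler_sum// => i _.
rewrite normrM mulrC ler_pM// ?enorm_coord//.
by rewrite (bigD1 j)//= lerDl sumr_ge0.
Qed.

Lemma state_bound k : exists2 W : R, 0 <= W & forall v,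
  enorm (state f 0 v k) <= W * enorm v.
Proof.
elim: k => [|k [W W0 IH]].
  by exists 0 => // v; rewrite mul0r /= enorm0.
pose a (d : nat) (C : 'M[R]_(d, n)) := n%:R * \sum_i \sum_j `|C i j|.
have a0 d C : 0 <= a d C.
  by rewrite mulr_ge0// sumr_ge0// => i _; rewrite sumr_ge0.
exists (a _ A^T * W + a _ B^T) => [|v]; first by rewrite addr_ge0// mulr_ge0.
rewrite /= /lin_dyn (le_trans (enorm_triangle _ _ _))// mulrDl lerD//.
  apply: le_trans (enorm_mulmx _ _ _ _) _; rewrite -[leRHS]mulrA.
  exact: (ler_wpM2l (a0 _ A^T) (IH v)).
apply: le_trans (enorm_mulmx _ _ _ _) _.
exact: (ler_wpM2l (a0 _ B^T) (enorm_control _ _ v k)).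
Qed.

Lemma C2_control (k : nat) l : C2 (fun U => control U k 0 l).
Proof.
have [kN|Nk] := ltnP k N.
  rewrite (_ : (fun U => _) = fun U => U 0 (mxvec_index (Ordinal kN) l)).
    exact: C2_coord.
  by apply/funext => U; rewrite -[k]/(val (Ordinal kN)) controlE.
rewrite (_ : (fun U => _) = fun=> 0); first exact: C2_cst.
by apply/funext => U; rewrite control_out// mxE.
Qed.

Lemma C2_mulmx d e m (z : 'rV[R]_m -> 'rV[R]_d) (C : 'M[R]_(d, e)) j :
  (forall i, C2 (fun y => z y 0 i)) -> C2 (fun y => (z y *m C) 0 j).
Proof.
move=> zC; rewrite (_ : (fun y => _) = fun y => \sum_i C i j * z y 0 i).
  by apply: C2_sum => i; exact: C2_scale.
by apply/funext => y; rewrite mxE; apply: eq_bigr => i _; rewrite mulrC.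
Qed.

Lemma C2_state x k j : C2 (fun U => state f x U k 0 j).
Proof.
elim: k j => [|k IH] j; first exact: C2_cst.
rewrite (_ : (fun U => _) = fun U => (state f x U k *m A^T) 0 j +
    (control U k *m B^T) 0 j); last by apply/funext => U; rewrite /= mxE.
apply: C2_add; first exact: C2_mulmx.
by apply: C2_mulmx => i; exact: C2_control.
Qed.

Variables (g l1 : 'rV[R]_n -> R) (l2 : 'rV[R]_q -> R).
Hypotheses (gC : C2 g) (l1C : C2 l1) (l2C : C2 l2).
Local Notation J := (cost (N := N) f g l1 l2).

Lemma C2_cost x : C2 (J x).
Proof.
apply: C2_add; first by apply: (C2_comp _ _ g) => // j; exact: C2_state.
apply: C2_sum => k; apply: C2_add.
  by apply: (C2_comp _ _ l1 (fun U => state f x U k)) => // j; exact: C2_state.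
by apply: (C2_comp _ _ l2 (fun U => control U k)) => // j; exact: C2_control.
Qed.

(** The states and controls are affine along a line of control sequences, so
    the second derivative of the cost along it is the sum of those of its
    terms. *)
Lemma qform_cost x U v :
  qform (hessian (J x) U) v =
  qform (hessian g (state f x U N)) (state f 0 v N) +
  \sum_(k < N) (qform (hessian l1 (state f x U k)) (state f 0 v k) +
                qform (hessian l2 (control U k)) (control v k)).
Proof.
have JL s : J x (U + s *: v) =
    g (state f x U N + s *: state f 0 v N) +
    \sum_(k < N) (l1 (state f x U k + s *: state f 0 v k) +
                  l2 (control U k + s *: control v k)).
  rewrite /cost /running_cost state_line; congr (_ + _).
  by apply: eq_bigr => k _; rewrite state_line control_line.
have sumd (F : R -> R) (G H : 'I_N -> R -> R) (dF : R) (dG dH : 'I_N -> R) (s : R) :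
    is_derive s 1 F dF -> (forall k, is_derive s 1 (G k) (dG k)) ->
    (forall k, is_derive s 1 (H k) (dH k)) ->
    is_derive s 1 (fun s => F s + \sum_(k < N) (G k s + H k s))
      (dF + \sum_(k < N) (dG k + dH k)).
  move=> FD GD HD.
  rewrite (_ : (fun s => _) = F + \sum_(k < N) (G k + H k)); last first.
    by apply/funext => t; rewrite fctE fct_sumE.
  by apply: is_deriveD; apply: is_derive_sum => k; exact: is_deriveD.
have D1 s : dotp (grad (J x) (U + s *: v)) v =
    dotp (grad g (state f x U N + s *: state f 0 v N)) (state f 0 v N) +
    \sum_(k < N) (dotp (grad l1 (state f x U k + s *: state f 0 v k)) (state f 0 v k) +
                  dotp (grad l2 (control U k + s *: control v k)) (control v k)).
  have [_ <-] := grad_line _ _ U v s (C2_cost x).1.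
  rewrite (funext JL); apply: derive_val.
  apply: sumd => [|k|k]; apply: grad_line; [exact: gC.1|exact: l1C.1|exact: l2C.1].
have := hess_line _ _ U v v 0 (C2_cost x).
rewrite scale0r addr0 -qformE => -[_ <-].
rewrite (funext D1); apply: derive_val.
have e d (y w : 'rV[R]_d) (h : 'rV[R]_d -> R) : C2 h ->
    is_derive (0 : R) 1 (fun s : R => dotp (grad h (y + s *: w)) w) (qform (hessian h y) w).
  by move=> hC; have := hess_line _ _ y w w 0 hC; rewrite scale0r addr0 qformE.
apply: (sumd (fun s => dotp (grad g (state f x U N + s *: state f 0 v N)) (state f 0 v N))
  (fun k s => dotp (grad l1 (state f x U k + s *: state f 0 v k)) (state f 0 v k))
  (fun k s => dotp (grad l2 (control U k + s *: control v k)) (control v k))) => [|k|k];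
exact: e.
Qed.

End Trajectories.

Section CompactCurvature.
Context {R : realType}.

Lemma qform0 d (H : 'M[R]_d) : qform H 0 = 0.
Proof. by rewrite qformE mul0mx dotp0l. Qed.

Lemma qformZ d (H : 'M[R]_d) c v : qform H (c *: v) = c ^+ 2 * qform H v.
Proof. by rewrite !qformE -scalemxAl dotpZl dotpZr mulrA. Qed.

Lemma continuous_qform d (f : 'rV[R]_d -> R) : C2 f ->
  continuous (fun w : 'rV[R]_(d + d) => qform (hessian f (lsubmx w)) (rsubmx w)).
Proof.
move=> [_ fdC].
rewrite (_ : (fun w => _) = fun w : 'rV[R]_(d + d) => \sum_j
   (\sum_i w 0 (rshift d i) * 'D_('e_i) (fun x => 'D_('e_j) f x) (lsubmx w)) *
   w 0 (rshift d j)); last first.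
  apply/funext => w; rewrite qformE; apply: eq_bigr => j _; rewrite mxE [rsubmx w 0 j]mxE.
  by congr (_ * _); apply: eq_bigr => i _; rewrite !mxE.
have lc : continuous (fun w : 'rV[R]_(d + d) => lsubmx w).
  move=> w; apply: (@continuous_row R _ d (fun w : 'rV[R]_(d + d) => lsubmx w)
    (nbhs w) (lsubmx w) (nbhs_filter w)) => j.
  rewrite mxE; under [X in X @ _ --> _]eq_fun do rewrite mxE.
  exact: coord_continuous.
apply: continuous_sumr => j; apply: continuous_mulr; last exact: coord_continuous.
apply: continuous_sumr => i; apply: continuous_mulr; first exact: coord_continuous.
have [_ _ fc] := fdC j; exact: (continuous_compr _ _ _ _ _ (fc i) lc).
Qed.

Lemma continuous_dotp_rsub d :
  continuous (fun w : 'rV[R]_(d + d) => dotp (rsubmx w) (rsubmx w)).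
Proof.
rewrite (_ : (fun w => _) = fun w : 'rV[R]_(d + d) =>
    \sum_j w 0 (rshift d j) * w 0 (rshift d j)); last first.
  by apply/funext => w; apply: eq_bigr => j _; rewrite !mxE.
by apply: continuous_sumr => j; apply: continuous_mulr; exact: coord_continuous.
Qed.

(** Compactness of the product of the cube and the unit sphere. As the least value
    m is attained, it is positive when all Hessians are positive definite. *)
Lemma curvature_bounds d (f : 'rV[R]_d -> R) (rho : R) : C2 f -> (0 < d)%N ->
  0 <= rho -> exists (y0 v0 : 'rV[R]_d) (m K : R),
  [/\ v0 != 0, m = qform (hessian f y0) v0 &
    forall y v, cube rho y ->
    m * dotp v v <= qform (hessian f y) v <= K * dotp v v].
Proof.
move=> fC d0 rho0.
pose S : set 'rV[R]_(d + d) :=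
  [set w | cube rho (lsubmx w) /\ dotp (rsubmx w) (rsubmx w) = 1].
have Sc : compact S.
  apply: bounded_closed_compact.
    exists (1 + rho); split; first exact: num_real.
    move=> x rx w [wc w1].
    have x0 : 0 <= x by rewrite ltW// (le_lt_trans _ rx)// addr_ge0.
    rewrite /= [leLHS]/Num.Def.normr/= mx_normrE (bigmax_le _ x0)//= => -[i j] _ /=.
    rewrite (ord1 i) (le_trans _ (ltW rx))//.
    rewrite -(hsubmxK w); case: (split_ordP j) => k ->.
      by rewrite row_mxEl (le_trans (wc k))// lerDr.
    rewrite row_mxEr (le_trans (enorm_coord _ _ _))// enormE w1 sqrtr1 lerDl//.
  rewrite (_ : S = \bigcap_i ((fun w : 'rV[R]_(d + d) => w 0 (lshift d i)) @^-1`
       [set t | `|t| <= rho]) `&`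
       (fun w => dotp (rsubmx w) (rsubmx w)) @^-1` [set 1]).
    apply: closedI.
      apply: closed_bigI => i _; apply: closed_comp => [w _|].
        exact: coord_continuous.
      rewrite (_ : [set t | _] = Num.norm @^-1` [set t | t <= rho])//.
      apply: closed_comp; last exact: closed_le.
      by move=> t _; exact: norm_continuous.
    by apply: closed_comp => [w _|]; [exact: continuous_dotp_rsub|exact: closed_eq].
  apply/seteqP; split=> w [wc w1]; split=> //.
    by move=> i _; have := wc i; rewrite mxE.
  by move=> i; have := wc i Logic.I; rewrite mxE.
have S0 : S !=set0.
  exists (row_mx 0 'e_(Ordinal d0)); split; rewrite ?row_mxKl ?row_mxKr.
    by move=> i; rewrite mxE normr0.
  by rewrite dotp_delta mxE !eqxx.
have scale m K :
    (forall w, w \in S -> m <= qform (hessian f (lsubmx w)) (rsubmx w)) ->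
    (forall w, w \in S -> qform (hessian f (lsubmx w)) (rsubmx w) <= K) ->
    forall y v, cube rho y ->
    m * dotp v v <= qform (hessian f y) v <= K * dotp v v.
  move=> mP KP y v yc; have [/enorm_eq0 ->|] := eqVneq (enorm v) 0.
    by rewrite dotp0l qform0 !mulr0 lexx.
  move=> v0; have vS : row_mx y ((enorm v)^-1 *: v) \in S.
    apply/mem_set; split; rewrite ?row_mxKl ?row_mxKr//.
    by rewrite dotpZl dotpZr -sqr_enorm; field.
  have := mP _ vS; have := KP _ vS; rewrite !row_mxKl !row_mxKr.
  rewrite qformZ -sqr_enorm.
  have v2 : 0 < enorm v ^+ 2 by rewrite exprn_gt0// lt_neqAle eq_sym v0 enorm_ge0.
  rewrite exprVn mulrC ler_pdivrMr// ler_pdivlMr// => h1 h2.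
  by apply/andP.
have cont := continuous_subspaceT (continuous_qform d f fC).
have [w wS wmin] := EVT_min_rV S0 Sc (cont S).
have [w' _ wmax] := EVT_max_rV S0 Sc (cont S).
exists (lsubmx w), (rsubmx w), (qform (hessian f (lsubmx w)) (rsubmx w)).
exists (qform (hessian f (lsubmx w')) (rsubmx w')); split; [|by []|exact: scale].
have [_ w1] := set_mem wS; apply/eqP => w0; move: w1; rewrite w0 dotp0l.
by move/esym/eqP; rewrite oner_eq0.
Qed.

End CompactCurvature.

Section CostCurvature.
Context {R : realType} (n q N : nat) (A : 'M[R]_n) (B : 'M[R]_(n, q)).
Hypotheses (n0 : (0 < n)%N) (q0 : (0 < q)%N) (N0 : (0 < N)%N).
Local Notation f := (lin_dyn A B).
Variables (g l1 : 'rV[R]_n -> R) (l2 : 'rV[R]_q -> R).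
Hypotheses (gC : C2 g) (l1C : C2 l1) (l2C : C2 l2).
Hypotheses (g_psd : forall x, psd (hessian g x))
  (l1_psd : forall x, psd (hessian l1 x)) (l2_pd : forall u, pd (hessian l2 u)).
Local Notation J := (cost (N := N) f g l1 l2).
Variables (Om : set 'rV[R]_n) (U0 : 'rV[R]_(N * q)) (r rho : R).
Hypotheses (r0 : 0 <= r) (rho0 : 0 <= rho) (Om0 : Om !=set0).
Hypothesis ball_cube : eball U0 r `<=` cube rho.
Hypothesis state_cube : forall k x U, (k <= N)%N -> Om x -> eball U0 r U ->
  cube rho (state f x U k).

Let curv := curvatures J Om (eball U0 r).

(** In the sum for the second derivative of the cost, the terms of g and l1 are
    nonnegative, and those of l2 control all components of v because each control
    enters one of them. *)
Lemma cost_curvature_bounds : exists m K : R, 0 < m /\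
  forall x U v, Om x -> eball U0 r U ->
    m * dotp v v <= qform (hessian (J x) U) v <= K * dotp v v.
Proof.
have [yg [vg [mg [Kg [_ _ gB]]]]] := curvature_bounds _ g rho gC n0 rho0.
have [y1 [v1 [m1 [K1 [_ _ l1B]]]]] := curvature_bounds _ l1 rho l1C n0 rho0.
have [u2 [w2 [m [K2 [w20 mE l2B]]]]] := curvature_bounds _ l2 rho l2C q0 rho0.
have m0 : 0 < m by rewrite mE; exact: l2_pd.
have [W WP] := choice (fun k => let: ex_intro2 W W0 WP := state_bound n q N A B k in
  ex_intro (fun W => 0 <= W /\ forall v, enorm (state f 0 v k) <= W * enorm v)
    W (conj W0 WP)).
have up d (h : 'rV[R]_d -> R) K y w v c :
    (forall y v, cube rho y -> qform (hessian h y) v <= K * dotp v v) ->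
    cube rho y -> enorm w <= c * enorm v :> R ->
    qform (hessian h y) w <= `|K| * c ^+ 2 * dotp (v : 'rV[R]_(N * q)) v.
  move=> hK yc wc; rewrite (le_trans (hK y w yc))//.
  rewrite (le_trans (ler_wpM2r (dotp_ge0 _ w) (ler_norm K)))// -mulrA.
  rewrite ler_wpM2l// -!sqr_enorm -exprMn ler_pXn2r// nnegrE ?enorm_ge0//.
  by rewrite (le_trans _ wc)// enorm_ge0.
exists m, (`|Kg| * W N ^+ 2 + \sum_(k < N) (`|K1| * W k ^+ 2 + `|K2| * 1 ^+ 2)).
split=> // x U v xO UB; rewrite qform_cost//.
have uc k : cube rho (control U k) by apply: cube_control => //; exact: ball_cube.
have sc (k : 'I_N) : cube rho (state f x U k).
  by apply: state_cube => //; exact: ltnW.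
apply/andP; split.
  rewrite dotp_control mulr_sumr -[leLHS]add0r lerD//; first exact: g_psd.
  apply: ler_sum => k _; rewrite -[leLHS]add0r lerD//; first exact: l1_psd.
  by have /andP[] := l2B _ (control v k) (uc k).
rewrite mulrDl lerD//.
  apply: up (state_cube _ _ _ (leqnn N) xO UB) ((WP N).2 v) => y w yc.
  by have /andP[] := gB y w yc.
rewrite mulr_suml ler_sum// => k _; rewrite mulrDl lerD//.
  apply: up (sc k) ((WP k).2 v) => y w yc.
  by have /andP[] := l1B y w yc.
apply: up (uc k) _; last by rewrite mul1r; exact: enorm_control.
by move=> y w yc; have /andP[] := l2B y w yc.
Qed.

Lemma cost_curvature :
  [/\ 0 < inf curv, inf curv <= sup curv &
    forall x U v, Om x -> eball U0 r U ->
    inf curv * dotp v v <= qform (hessian (J x) U) v <= sup curv * dotp v v].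
Proof.
have [m [K [m0 mK]]] := cost_curvature_bounds.
have curvP t : curv t -> m <= t <= K.
  move=> [x [U [v [xO UB v1 ->]]]]; have := mK x U v xO UB.
  by rewrite -sqr_enorm v1 expr1n !mulr1.
have lb : has_lbound curv by exists m => t /curvP/andP[].
have ub : has_ubound curv by exists K => t /curvP/andP[].
have [x0 x0O] := Om0.
have p0 : (0 < N * q)%N by rewrite muln_gt0 N0.
have c0 : curv (qform (hessian (J x0) U0) 'e_(Ordinal p0)).
  exists x0, U0, 'e_(Ordinal p0); split=> //.
    by rewrite /eball /= subrr enorm0.
  by rewrite enormE dotp_delta mxE !eqxx sqrtr1.
split.
- apply: (lt_le_trans m0); apply: lb_le_inf.
    by exists (qform (hessian (J x0) U0) 'e_(Ordinal p0)).
  by move=> t /curvP/andP[].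
- by apply: (le_trans (ge_inf lb c0)); exact: ub_le_sup.
move=> x U v xO UB; have [/enorm_eq0 ->|v0] := eqVneq (enorm v) 0.
  by rewrite dotp0l qform0 !mulr0 lexx.
have v2 : 0 < enorm v ^+ 2 by rewrite exprn_gt0// lt_neqAle eq_sym v0 enorm_ge0.
have : curv (qform (hessian (J x) U) ((enorm v)^-1 *: v)).
  exists x, U, ((enorm v)^-1 *: v); split=> //.
  by rewrite enormZ normfV ger0_norm ?enorm_ge0// mulVf.
move=> cv; have := ge_inf lb cv; have := ub_le_sup ub cv.
rewrite qformZ exprVn mulrC ler_pdivrMr// ler_pdivlMr// sqr_enorm => h1 h2.
by apply/andP.
Qed.

End CostCurvature.

(** * Networks for the gradient method *)

Section Realization.
Context {R : realType} (sigma : R -> R).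

(** F can be computed with at most c new entries after any continuation of the
    list ks. Quantifying over the continuations lets the computations of several
    functions be placed one after another. *)
Definition realizable {n : nat} (ks : seq ('rV[R]_n -> R)) (c : nat)
    (F : 'rV[R]_n -> R) : Prop :=
  forall ks', net sigma (ks ++ ks') -> exists ls,
    [/\ net sigma (ks ++ ks' ++ ls), (size ls <= c)%N & aspan (ks ++ ks' ++ ls) F].

Lemma realizable_app n m (ks : seq ('rV[R]_n -> R)) (hs : seq ('rV[R]_m -> R))
    (phi : 'rV[R]_n -> 'rV[R]_m) h :
  net sigma hs -> aspan hs h -> (forall j, aspan ks (fun x => phi x 0 j)) ->
  realizable ks (size hs) (h \o phi).
Proof.
move=> hsN hP phiP ks' ksN; exists [seq h \o phi | h <- hs].
have phiP' j : aspan (ks ++ ks') (fun x => phi x 0 j) by exact: aspan_catl.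
rewrite size_map catA; split=> //; [exact: net_subst|exact: aspan_subst].
Qed.

Lemma realize_family n (ks : seq ('rV[R]_n -> R)) c m (F : nat -> 'rV[R]_n -> R) :
  net sigma ks -> (forall i, (i < m)%N -> realizable ks c (F i)) ->
  forall ks', net sigma (ks ++ ks') -> exists ls, [/\ net sigma (ks ++ ks' ++ ls),
    (size ls <= m * c)%N &
    forall i, (i < m)%N -> aspan (ks ++ ks' ++ ls) (F i)].
Proof.
move=> ksN; elim: m => [|m IH] FP ks' ksN'.
  by exists [::]; rewrite cats0; split.
have [|ls [lsN lss lsP]] := IH _ ks' ksN'; first by move=> i im; apply: FP; exact: ltnW.
have [ls' [lsN' lss' lsP']] := FP m (ltnSn m) (ks' ++ ls) lsN.
rewrite -!catA in lsN' lsP'; exists (ls ++ ls'); split=> //.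
  by rewrite size_cat mulSn addnC leq_add.
move=> i; rewrite ltnS leq_eqVlt => /orP[/eqP ->//|/lsP H].
by have := aspan_catl _ _ ls' _ H; rewrite -!catA.
Qed.

Lemma realizable_sum n (ks : seq ('rV[R]_n -> R)) c m (F : nat -> 'rV[R]_n -> R) :
  net sigma ks -> (forall i, (i < m)%N -> realizable ks c (F i)) ->
  realizable ks (m * c) (fun x => \sum_(i < m) F i x).
Proof.
move=> ksN FP ks' ksN'; have [ls [lsN lss lsP]] := realize_family _ _ _ _ _ ksN FP ks' ksN'.
by exists ls; split=> //; apply: aspan_sum => i; exact: lsP.
Qed.

Lemma realizable_add n (ks : seq ('rV[R]_n -> R)) c d F G :
  realizable ks c F -> realizable ks d G ->
  realizable ks (c + d) (fun x => F x + G x).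
Proof.
move=> FP GP ks' ksN'.
have [ls [lsN lss lsP]] := FP _ ksN'.
have [ls' [lsN' lss' lsP']] := GP _ lsN.
rewrite -!catA in lsN' lsP'; exists (ls ++ ls'); split=> //.
  by rewrite size_cat leq_add.
by apply: aspan_add => //; have := aspan_catl _ _ ls' _ lsP; rewrite -!catA.
Qed.

Section Cost.
Variables (n q N : nat) (A : 'M[R]_n) (B : 'M[R]_(n, q)).
Local Notation f := (lin_dyn A B).
Variables (g l1 : 'rV[R]_n -> R) (l2 : 'rV[R]_q -> R).
Variables (hg h1 : seq ('rV[R]_n -> R)) (h2 : seq ('rV[R]_q -> R)).
Hypotheses (hgN : net sigma hg) (h1N : net sigma h1) (h2N : net sigma h2).
Hypotheses (gP : aspan hg g) (l1P : aspan h1 l1) (l2P : aspan h2 l2).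
Local Notation J := (cost (N := N) f g l1 l2).

Definition cost_nodes := (size hg + N * (size h1 + size h2))%N.

Lemma aspan_control ks (U : 'rV[R]_n -> 'rV[R]_(N * q)) k l :
  (forall j, aspan ks (fun x => U x 0 j)) ->
  aspan ks (fun x => control (U x) k 0 l).
Proof.
move=> UP; have [kN|Nk] := ltnP k N.
  rewrite (_ : (fun x => _) = fun x => U x 0 (mxvec_index (Ordinal kN) l)).
    exact: UP.
  by apply/funext => x; rewrite -[k]/(val (Ordinal kN)) controlE.
under [X in aspan _ X]eq_fun do rewrite control_out// mxE.
exact: aspan_const.
Qed.

Lemma aspan_state ks (U : 'rV[R]_n -> 'rV[R]_(N * q)) k l :
  (forall j, aspan ks (fun x => U x 0 j)) ->
  aspan ks (fun x => state f x (U x) k 0 l).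
Proof.
move=> UP; elim: k l => [|k IH] l; first exact: aspan_coord.
rewrite (_ : (fun x => _) = fun x =>
    \sum_i A^T i l * state f x (U x) k 0 i +
    \sum_i B^T i l * control (U x) k 0 i).
  apply: aspan_add; apply: aspan_sum => i; apply: aspan_scale => //.
  exact: aspan_control.
apply/funext => x; rewrite /= !mxE; congr (_ + _);
by apply: eq_bigr => i _; rewrite mulrC.
Qed.

(** The states, being affine in the initial state and the controls, cost no
    node; hence the state dimension does not enter the size. *)
Lemma realizable_cost ks (U : 'rV[R]_n -> 'rV[R]_(N * q)) : net sigma ks ->
  (forall j, aspan ks (fun x => U x 0 j)) ->
  realizable ks cost_nodes (fun x => J x (U x)).
Proof.
move=> ksN UP; apply: realizable_add.
  by apply: (realizable_app _ _ _ hg) => // j; exact: aspan_state.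
apply: (realizable_sum _ _ _ _
  (fun k x => l1 (state f x (U x) k) + l2 (control (U x) k))) => // k kN.
apply: realizable_add.
  apply: (realizable_app _ _ _ h1 (fun x => state f x (U x) k)) => // j.
  exact: aspan_state.
apply: (realizable_app _ _ _ h2 (fun x => control (U x) k)) => // j.
exact: aspan_control.
Qed.

End Cost.

Definition fd_descent {n p : nat} (J : 'rV[R]_n -> 'rV[R]_p -> R)
    (U0 : 'rV[R]_p) (t h : R) (k : nat) (x : 'rV[R]_n) : 'rV[R]_p :=
  iter k (fun U => U - h *: \row_i ((J x (U + t *: 'e_i) - J x U) / t)) U0.

(** One step needs the cost at the current iterate and at one test point for each
    of the p coordinates; the rest of the step is affine. *)
Lemma net_descent n p (J : 'rV[R]_n -> 'rV[R]_p -> R) U0 t h c :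
  (forall ks (U : 'rV[R]_n -> 'rV[R]_p), net sigma ks ->
    (forall j, aspan ks (fun x => U x 0 j)) -> realizable ks c (fun x => J x (U x))) ->
  forall k, exists ks, [/\ net sigma ks, (size ks <= k * (p.+1 * c))%N &
    forall j, aspan ks (fun x => fd_descent J U0 t h k x 0 j)].
Proof.
move=> JP; elim=> [|k [ks [ksN kss ksP]]].
  by exists [::]; split=> // j; exact: aspan_const.
pose U := fd_descent J U0 t h k.
(* F 0 is the cost at the iterate, F i.+1 that at its test point number i. *)
pose F i x := if i is i'.+1 then
    if insub i' is Some j then J x (U x + t *: 'e_(j : 'I_p)) else 0
  else J x (U x).
have FP i : (i < p.+1)%N -> realizable ks c (F i).
  case: i => [_|i ip]; first exact: JP.
  rewrite /F; case: insubP => [j _ _|/negP//].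
  apply: (JP _ (fun x => U x + t *: 'e_j)) => // l.
  under [X in aspan _ X]eq_fun do rewrite mxE.
  by apply: aspan_add => //; exact: aspan_const.
have [|ls [lsN lss lsP]] := realize_family _ _ _ _ _ ksN FP [::]; first by rewrite cats0.
exists (ks ++ ls); split=> //.
  by rewrite size_cat mulSn addnC leq_add.
move=> j.
rewrite (_ : (fun x => _) = fun x => U x 0 j +
    (- h * t^-1) * (F j.+1 x + (-1) * F 0 x)); last first.
  apply/funext => x; rewrite {1}/fd_descent iterS -/(fd_descent J U0 t h k x).
  by rewrite -/(U x) /F /= valK !mxE; ring.
apply: aspan_add; first exact: aspan_catl.
apply: aspan_scale; apply: aspan_add; first by apply: lsP; rewrite ltnS.
by apply: aspan_scale; apply: lsP.
Qed.

End Realization.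

(** * Error of the inexact gradient method *)

Section DescentError.
Context {R : realType} {n p : nat}.
Variables (f fN : 'rV[R]_p -> R) (U0 V : 'rV[R]_p) (gamma mu M kappa s t delta : R).
Hypotheses (fC : C2 f) (mu0 : 0 < mu) (muM : mu <= M).
Hypothesis fH : forall x v, eball U0 (2 * gamma) x ->
  mu * dotp v v <= qform (hessian f x) v <= M * dotp v v.
Hypotheses (gamma0 : 0 < gamma) (VB : eball U0 gamma V) (Vcrit : grad f V = 0).
Hypothesis fNP : forall U, eball U0 (2 * gamma) U -> `|fN U - f U| <= delta.
Hypothesis kappaE : kappa = mu ^+ 2 / (2 * M ^+ 2).
Hypotheses (s0 : 0 < s) (s_small : s <= gamma / 2).
Hypotheses (t0 : 0 < t) (t_small : t <= kappa * gamma / 2).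
Hypothesis tP : p%:R * (M * t + 2 * delta / t) <= mu * s / 2.

Lemma kappa_bounds : 0 < kappa <= 1.
Proof.
have M0 : 0 < M by exact: lt_le_trans muM.
rewrite kappaE divr_gt0 ?mulr_gt0 ?exprn_gt0//= ler_pdivrMr ?mulr_gt0 ?exprn_gt0//.
have := sqr_ge0 M; have : mu ^+ 2 <= M ^+ 2 by rewrite ler_pXn2r// nnegrE ltW.
by rewrite mul1r; lra.
Qed.

(** The invariant keeps the iterates and the test points of the differences in
    the ball where the curvature bounds hold: the first iterate is its center,
    and the later ones have gained kappa * gamma. *)
Lemma descent_error k :
  let U := iter k (fun U => U - (mu / M ^+ 2) *:
     \row_i ((fN (U + t *: 'e_i) - fN U) / t)) U0 in
  [/\ enorm (U - V) <= gamma, enorm (U - U0) + t <= 2 * gamma &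
      enorm (U - V) <= (1 - kappa) ^+ k * gamma + s].
Proof.
have /andP[k0 k1] := kappa_bounds.
have kg : kappa * gamma <= gamma by rewrite ler_piMl// ltW.
have M0 : 0 < M by exact: lt_le_trans muM.
have [g0 s0' ss ts t0'] := And5 gamma0 s0 s_small t_small t0.
have d0 : 0 <= delta.
  apply: le_trans (normr_ge0 _) (fNP U0 _).
  by rewrite /eball /= subrr enorm0 mulr_ge0// ltW.
elim: k => [|k] /=.
  have UV : enorm (U0 - V) <= gamma by rewrite -enormN opprB.
  rewrite subrr enorm0 expr0 mul1r add0r; split=> //.
    by lra.
  by rewrite ler_wpDr// ltW.
set U := iter k _ _ => -[eg eB ek].
have UB : eball U0 (2 * gamma) U by rewrite /eball /=; lra.
have VB2 : eball U0 (2 * gamma) V by move: VB; rewrite /eball /=; lra.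
have UtB i : eball U0 (2 * gamma) (U + t *: 'e_i).
  rewrite /eball /= addrAC (le_trans (enorm_triangle _ _ _))//.
  rewrite enormZ (gtr0_norm t0) [enorm 'e_i]enormE dotp_delta mxE !eqxx sqrtr1.
  by rewrite mulr1.
set G := \row_i _; set h := mu / M ^+ 2.
have h0 : 0 < h by rewrite divr_gt0// exprn_gt0.
have GP : enorm (G - grad f U) <= mu * s / 2.
  apply: le_trans tP; apply: enorm_le => [|i].
    rewrite addr_ge0//; first by rewrite mulr_ge0// ltW.
    by rewrite divr_ge0 ?mulr_ge0// ltW.
  have := forward_difference f U0 (2 * gamma) mu M fC mu0 fH U i t delta _ _ t0 UB (UtB i)
    (fNP _ (UtB i)) (fNP _ UB).
  suff -> : (G - grad f U) 0 i =
    (fN (U + t *: 'e_i) - fN U) / t - grad f U 0 i by [].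
  by rewrite !mxE.
have step : enorm (U - h *: G - V) <= (1 - kappa) * enorm (U - V) + kappa * s.
  rewrite (_ : _ - V = (U - h *: grad f U - V) + - (h *: (G - grad f U))); last first.
    by apply/rowP => i; rewrite !mxE; ring.
  rewrite (le_trans (enorm_triangle _ _ _))// enormN enormZ (gtr0_norm h0) lerD//.
    rewrite kappaE; exact: (gradient_step f U0 (2 * gamma) mu M fC mu0 muM fH).
  rewrite (_ : kappa * s = h * (mu * s / 2)) ?ler_pM2l//.
  by rewrite kappaE /h; field; rewrite gt_eqF.
have e' : enorm (U - h *: G - V) <= (1 - kappa) * gamma + kappa * s.
  by apply: le_trans step _; rewrite lerD2r ler_wpM2l//; lra.
split.
- by nra.
- rewrite (_ : U - h *: G - U0 = (U - h *: G - V) + (V - U0)); last first.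
    by rewrite addrA subrK.
  have := enorm_triangle _ (U - h *: G - V) (V - U0); move: VB; rewrite /eball /=.
  by nra.
- have : (1 - kappa) * enorm (U - V) <= (1 - kappa) * ((1 - kappa) ^+ k * gamma + s).
    by rewrite ler_wpM2l//; lra.
  by rewrite exprS; lra.
Qed.

End DescentError.

(** Bernoulli's inequality. It bounds the number of steps by a multiple of 1 / s,
    which costs one power of the accuracy. *)
Lemma geometric_decay {R : realType} (kappa : R) k : 0 <= kappa -> kappa <= 1 ->
  (1 - kappa) ^+ k * (1 + k%:R * kappa) <= 1.
Proof.
move=> k0 k1; elim: k => [|k IH]; first by rewrite expr0 mul0r addr0 mul1r.
apply: le_trans IH; rewrite exprSr -mulrA ler_wpM2l ?exprn_ge0 ?subr_ge0//.
have := ler0n R k; rewrite -natr1; nra.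
Qed.

(** * Assembly *)

Section Rates.
Context {R : realType}.

(** An approximation of rate nw^(-1/ri) reaches the error a / X when nw is X^r. *)
Lemma powR_rate (r ri X nw a : R) : 0 < ri -> ri <= r -> 1 <= X ->
  X `^ r <= nw -> 0 <= a -> a * nw `^ (- ri^-1) <= a / X.
Proof.
move=> ri0 rir X1 nwX a0; rewrite ler_wpM2l// powRN.
have X0 : 0 < X by exact: lt_le_trans X1.
have Xr0 : 0 <= X `^ r by exact: powR_ge0.
have nw0 : 0 <= nw by exact: le_trans nwX.
have XX : X <= nw `^ ri^-1.
  apply: (@le_trans _ _ ((X `^ r) `^ ri^-1)); last first.
    by apply: ge0_ler_powR => //; rewrite ?nnegrE// invr_ge0 ltW.
  rewrite -powRrM -[leLHS]powRr1; last exact: ltW.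
  by apply: ler_powR => //; rewrite ler_pdivlMr// mul1r.
by rewrite lef_pV2// posrE; exact: lt_le_trans XX.
Qed.

(** With w = q / s >= 1, there are O(1 / s) steps, each evaluating O(q) costs by
    nets of width O(w^(2 r)), so the size is O(w^(2 r + 1)). Since s <= 1, the
    factor (1 / s)^(2 r + 1) is at most (1 / s)^(8 r + 1). *)
Lemma size_bound (gamma kappa s q V N Y r nw K m : R) :
  0 < gamma -> 0 < kappa -> 0 < s -> s <= 1 -> 1 <= q -> 0 <= V -> 1 <= N ->
  1 <= Y -> 0 <= r -> 0 <= K -> 0 <= nw ->
  K <= 2 * gamma / (kappa * s) ->
  nw <= 2 * (Y * (q / s) ^+ 2) `^ r ->
  m <= 1 + K * ((N * q + 1) * (nw * V * N)) ->
  m <= (1 + 8 * gamma * N ^+ 2 * V * Y `^ r / kappa) * q `^ (2 * r + 1)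
       * s `^ (- (8 * r + 1)).
Proof.
move=> g0 k0 s0 s1 q1 V0 N1 Y1 r0 K0 nw0 KP nwP mP.
have q0 : 0 < q by exact: lt_le_trans q1.
set w := q / s in nwP.
have w1 : 1 <= w by rewrite ler_pdivlMr// mul1r (le_trans s1).
have w0 : 0 < w by exact: lt_le_trans w1.
have Y0 : 0 <= Y by exact: le_trans Y1.
set Z := _ / kappa.
have e1 : (Y * w ^+ 2) `^ r = Y `^ r * w `^ (2 * r).
  by rewrite powRM ?sqr_ge0// -powR_mulrn ?ltW// -powRrM.
have e2 : w `^ (2 * r + 1) = w `^ (2 * r) * w.
  by rewrite powRD ?powRr1 ?ltW//; apply/implyP => _; rewrite gt_eqF.
have N0 : 0 <= N by exact: le_trans N1.
have Z0 : 0 <= Z.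
  apply: divr_ge0; last exact: ltW.
  have g0' := ltW g0; have N2 := sqr_ge0 N; have Yr := powR_ge0 Y r.
  by do !apply: mulr_ge0.
have mw : m <= (1 + Z) * w `^ (2 * r + 1).
  apply: (le_trans mP); rewrite [leRHS]mulrDl mul1r lerD//.
    rewrite -[leLHS](_ : 1 `^ (2 * r + 1) = 1); last by rewrite powR1.
    by apply: ge0_ler_powR => //; rewrite ?nnegrE ?ler01 ?(ltW w0)//; lra.
  have h1 : N * q + 1 <= 2 * N * q by nra.
  have h2 : nw * V * N <= 2 * (Y * w ^+ 2) `^ r * V * N.
    by rewrite !ler_wpM2r.
  apply: (@le_trans _ _ (2 * gamma / (kappa * s) * ((2 * N * q) *
     (2 * (Y * w ^+ 2) `^ r * V * N)))).
    apply: ler_pM => //; last apply: ler_pM => //.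
    - by rewrite mulr_ge0 ?addr_ge0 ?mulr_ge0// ltW.
    - by rewrite addr_ge0 ?mulr_ge0// ltW.
    - by rewrite !mulr_ge0.
  rewrite e1 e2 /Z /w le_eqVlt; apply/orP; left; apply/eqP.
  by field; rewrite !gt_eqF.
apply: (le_trans mw); rewrite -[leRHS]mulrA ler_wpM2l ?addr_ge0//.
rewrite /w powRM; [|exact: ltW|by rewrite invr_ge0 ltW].
rewrite ler_wpM2l ?powR_ge0//.
have -> : s `^ (- (8 * r + 1)) = s^-1 `^ (8 * r + 1).
  by rewrite -powR_inv1 ?ltW// -powRrM mulN1r.
by apply: ler_powR; [rewrite invf_ge1|lra].
Qed.

End Rates.

Section Assembly.
Context {R : realType}.

Lemma cost_error n q N (f : 'rV[R]_n -> 'rV[R]_q -> 'rV[R]_n)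
    (g g' l1 l1' : 'rV[R]_n -> R) (l2 l2' : 'rV[R]_q -> R) (rho d : R) x
    (U : 'rV[R]_(N * q)) :
  (forall y, cube rho y -> `|g' y - g y| <= d) ->
  (forall y, cube rho y -> `|l1' y - l1 y| <= d) ->
  (forall y, cube rho y -> `|l2' y - l2 y| <= d) ->
  (forall k, (k <= N)%N -> cube rho (state f x U k)) ->
  (forall k, cube rho (control U k)) ->
  `|cost f g' l1' l2' x U - cost f g l1 l2 x U| <= (2 * N%:R + 1) * d.
Proof.
move=> gP l1P l2P sc uc; rewrite /cost /running_cost opprD addrACA -sumrB.
rewrite (le_trans (ler_normD _ _))// mulrDl mul1r [leRHS]addrC lerD//; first exact/gP/sc.
apply: le_trans (ler_norm_sum _ _ _) _.
have -> : 2 * N%:R * d = \sum_(k < N) (d + d).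
  by rewrite sumr_const card_ord -[RHS]mulr_natl; ring.
apply: ler_sum => k _; rewrite opprD addrACA (le_trans (ler_normD _ _))//.
by rewrite lerD//; [exact/l1P/sc/ltnW|exact/l2P/uc].
Qed.

Lemma kang_gong_net (sigma : R -> R) (K : set (nat * nat) -> R) :
  (forall (d q : nat) (F : compfun R d q) (rho : R) (m : cf_node F -> nat)
      (rad : cf_node F -> R) (phi : features R),
      assumptionA rho m rad -> is_features rho m rad phi ->
      forall nw : nat, (0 < nw)%N ->
      exists G : compfun R d q,
        [/\ is_NN sigma G,
            cf_size G = (nw * ft_general phi)%N &
            forall x, cube rho x ->
              enorm (cf_eval F x - cf_eval G x) <=
                K (dm_pairs m) * ft_Lambda phi * ft_Lmax phi
                * (ft_general phi)%:R * nw%:R `^ (- (ft_rmax phi)^-1)]) ->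
  forall (d : nat) (F : compfun R d 1) rho m rad phi,
  @assumptionA _ _ _ F rho m rad -> is_features rho m rad phi ->
  forall nw, (0 < nw)%N -> exists hs h,
    [/\ net sigma hs, (size hs <= nw * ft_general phi)%N, aspan hs h &
      forall x, cube rho x -> `|h x - cf_eval1 F x| <=
                K (dm_pairs m) * ft_Lambda phi * ft_Lmax phi
                * (ft_general phi)%:R * nw%:R `^ (- (ft_rmax phi)^-1)].
Proof.
move=> KG d F rho m rad phi FA Fphi nw nw0.
have [G [GN Gs GP]] := KG _ _ _ _ _ _ _ FA Fphi nw nw0.
have [hs [hsN hss hsP]] := net_of_NN sigma _ _ G GN.
exists hs, (fun x => cf_eval G x 0 0); split=> //; first by rewrite -Gs.
move=> x xc; apply: le_trans (GP x xc).
rewrite distrC; apply: le_trans (enorm_coord _ _ 0).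
by rewrite [(_ - cf_eval G x) 0 0]mxE [(- cf_eval G x) 0 0]mxE.
Qed.

(** The hypothesis on t and d bounds the error of the approximate gradients, and
    the last one says that K steps suffice: s (1 + K kappa) >= gamma makes the
    contraction (1 - kappa)^K gamma at most s. The other s is the accumulated
    error of the gradients. *)
Lemma descent_NN (sigma : R -> R) n q N (A : 'M[R]_n) (B : 'M[R]_(n, q))
    (g l1 g' l1' : 'rV[R]_n -> R) (l2 l2' : 'rV[R]_q -> R) hg h1 h2
    (Om : set 'rV[R]_n) (Ustar : 'rV[R]_n -> 'rV[R]_(N * q))
    (U0 : 'rV[R]_(N * q)) (gamma mu M kappa s t d : R) (rho : R) K :
  let f := lin_dyn A B in
  let J := cost (N := N) f g l1 l2 in
  (0 < n)%N -> (0 < q)%N -> (0 < N)%N -> 0 <= rho ->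
  C2 g -> C2 l1 -> C2 l2 ->
  0 < mu -> mu <= M ->
  (forall x U v, Om x -> eball U0 (2 * gamma) U ->
    mu * dotp v v <= qform (hessian (J x) U) v <= M * dotp v v) ->
  (forall x U, Om x -> J x (Ustar x) <= J x U) ->
  0 < gamma -> (forall x, Om x -> eball U0 gamma (Ustar x)) ->
  eball U0 (2 * gamma) `<=` cube rho ->
  (forall k x U, (k <= N)%N -> Om x -> eball U0 (2 * gamma) U ->
    cube rho (state f x U k)) ->
  net sigma hg -> net sigma h1 -> net sigma h2 ->
  aspan hg g' -> aspan h1 l1' -> aspan h2 l2' ->
  (forall y, cube rho y -> `|g' y - g y| <= d) ->
  (forall y, cube rho y -> `|l1' y - l1 y| <= d) ->
  (forall y, cube rho y -> `|l2' y - l2 y| <= d) ->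
  kappa = mu ^+ 2 / (2 * M ^+ 2) ->
  0 < s -> s <= gamma / 2 -> 0 < t -> t <= kappa * gamma / 2 ->
  (N * q)%:R * (M * t + 2 * ((2 * N%:R + 1) * d) / t) <= mu * s / 2 ->
  gamma <= s * (1 + K%:R * kappa) ->
  exists UNN : compfun R n (N * q),
    [/\ is_NN sigma UNN,
        forall x, Om x -> enorm (cf_eval UNN x - Ustar x) <= 2 * s &
        (cf_size UNN <= (K * ((N * q).+1 *
           (size hg + N * (size h1 + size h2)))).+1)%N].
Proof.
move=> f J n0 q0 N0 rho0 gC l1C l2C mu0 muM JH Jmin g0 UstarB ballc sc hgN h1N h2N
  gP l1P l2P gd l1d l2d kE s0 ss t0 ts tP Kg.
pose J' := cost (N := N) f g' l1' l2'.
pose h := mu / M ^+ 2.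
have [ks [ksN kss ksP]] := net_descent sigma n (N * q) J' U0 t h
   (cost_nodes n q N hg h1 h2)
   (fun ks U => realizable_cost sigma n q N A B g' l1' l2' hg h1 h2 hgN h1N h2N
      gP l1P l2P ks U) K.
have p0 : (0 < N * q)%N by rewrite muln_gt0 N0.
have [G [GN Gs GP]] := NN_of_net sigma n (N * q) ks
  (fun j x => fd_descent J' U0 t h K x 0 j) n0 p0 ksN ksP.
exists G; split=> //; last by rewrite Gs ltnS.
move=> x xO.
have -> : cf_eval G x = fd_descent J' U0 t h K x by apply/rowP => j; rewrite GP.
have JC : C2 (J x) by exact: C2_cost.
have JE U : eball U0 (2 * gamma) U -> `|J' x U - J x U| <= (2 * N%:R + 1) * d.
  move=> UB; apply: cost_error gd l1d l2d _ _ => [k kN|k]; first exact: sc.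
  by apply: cube_control => //; exact: ballc.
have [_ _] := descent_error (J x) (J' x) U0 (Ustar x) gamma mu M kappa s t _ JC mu0
  muM (fun U v => JH x U v xO) g0 (UstarB x xO)
  (grad_min _ _ _ JC.1 (fun U => Jmin x U xO)) JE kE s0 ss t0 ts tP K.
move=> /le_trans; apply.
have /andP[k0 k1] := kappa_bounds mu M kappa mu0 muM kE.
have := geometric_decay kappa K (ltW k0) k1.
have kp : 0 <= (1 - kappa) ^+ K by rewrite exprn_ge0// subr_ge0.
have K0 : 0 <= K%:R * kappa by rewrite mulr_ge0// ltW.
set a := (1 - kappa) ^+ K in kp *; set b := K%:R * kappa in K0 Kg * => ab.
have : a * gamma <= a * (s * (1 + b)) by rewrite ler_wpM2l.
by nra.
Qed.

End Assembly.

Section Constant.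
Context {R : realType} (K : set (nat * nat) -> R) (D : problem_data R).

Definition max_rate : R := Num.max 1 (Num.max (ft_rmax (pd_l1 D))
  (Num.max (ft_rmax (pd_l2 D)) (ft_rmax (pd_g D)))).

Definition approximation_factor (dm : set (nat * nat)) (phi : features R) : R :=
  K dm * ft_Lambda phi * ft_Lmax phi * (ft_general phi)%:R.

Definition total_factor : R :=
  approximation_factor (pd_dm_g D) (pd_g D) + approximation_factor (pd_dm_l1 D) (pd_l1 D) +
  approximation_factor (pd_dm_l2 D) (pd_l2 D).

Definition contraction : R := pd_curv_min D ^+ 2 / (2 * pd_curv_max D ^+ 2).

Definition general_count : nat :=
  (ft_general (pd_l1 D) + ft_general (pd_l2 D) + ft_general (pd_g D))%N.

(** The cost terms are needed with accuracy
    d = mu^2 s^2 / (32 M (N q)^2 (2 N + 1)), and total_factor / d is at most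
    width * (q / s)^2. The summand 1 makes this quantity at least 1. *)
Definition width : R :=
  1 + 32 * total_factor * (2 * (pd_horizon D)%:R + 1) * pd_curv_max D
      * (pd_horizon D)%:R ^+ 2 / pd_curv_min D ^+ 2.

(** Since |U*| <= |U0| + gamma, the zero network suffices when eps >= coarse. Only
    a network without hidden nodes will do for large eps, as the bound on the size
    tends to 0. *)
Definition coarse : R := (pd_center D + pd_gamma D) / 3.

(** The method is run at the accuracy s = fineness * eps. For eps < coarse this is
    at most gamma mu / (2 M), which keeps the iterates and the test points in the
    ball, and at most 1. *)
Definition fineness : R :=
  Num.min 1 (pd_gamma D * pd_curv_min D / (2 * pd_curv_max D))
  / Num.max 1 coarse.

Definition complexity : R :=
  Num.max 1 ((1 + 8 * pd_gamma D * (pd_horizon D)%:R ^+ 2 * general_count%:R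
     * width `^ max_rate / contraction) * fineness `^ (- (8 * max_rate + 1))).

Lemma complexity_gt0 : 0 < complexity.
Proof. by rewrite lt_max ltr01. Qed.

End Constant.

Lemma truncnS_bounds {R : realType} (x : R) : 1 <= x ->
  x <= (Num.truncn x).+1%:R <= 2 * x.
Proof.
move=> x1; have x0 : 0 <= x by exact: le_trans x1.
have /andP[h1 h2] := truncn_itv x0; rewrite (ltW h2) -natr1; lra.
Qed.

Theorem corollary3p7 (R : realType) (sigma : R -> R) (Hsigma : kang_gong sigma) :
  exists C : problem_data R -> R,
    (forall D, 0 < C D) /\
    forall (n q N : nat), (0 < n)%N -> (0 < q)%N -> (0 < N)%N ->
    forall (A : 'M[R]_n) (B : 'M[R]_(n, q))
      (g l1 : compfun R n 1) (l2 : compfun R q 1)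
      (Om : set 'rV[R]_n) (Ustar : 'rV[R]_n -> 'rV[R]_(N * q))
      (U0 : 'rV[R]_(N * q)) (gamma rho : R)
      (mg : cf_node g -> nat) (radg : cf_node g -> R) (phig : features R)
      (m1 : cf_node l1 -> nat) (rad1 : cf_node l1 -> R) (phi1 : features R)
      (m2 : cf_node l2 -> nat) (rad2 : cf_node l2 -> R) (phi2 : features R),
    let f := lin_dyn A B in
    let J := cost (N := N) f (cf_eval1 g) (cf_eval1 l1) (cf_eval1 l2) in
    all_nodes_C2 g -> all_nodes_C2 l1 -> all_nodes_C2 l2 ->
    (forall x, psd (hessian (cf_eval1 g) x)) ->
    (forall x, psd (hessian (cf_eval1 l1) x)) ->
    (forall u, pd (hessian (cf_eval1 l2) u)) ->
    compact Om ->
    (forall x, Om x ->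
       ereal_inf [set (J x U)%:E | U in [set: 'rV[R]_(N * q)]]
       = (J x (Ustar x))%:E) ->
    0 < gamma ->
    (forall x, Om x -> eball U0 gamma (Ustar x)) ->
    1 < rho ->
    Om `<=` cube rho ->
    eball U0 (2 * gamma) `<=` cube rho ->
    (forall k x U, (1 <= k <= N)%N -> Om x -> eball U0 (2 * gamma) U ->
       cube (rho / 2) (state f x U k) /\
       `|running_cost f (cf_eval1 l1) (cf_eval1 l2) k x U| <= rho / 2) ->
    assumptionA rho mg radg -> is_features rho mg radg phig ->
    assumptionA rho m1 rad1 -> is_features rho m1 rad1 phi1 ->
    assumptionA rho m2 rad2 -> is_features rho m2 rad2 phi2 ->
    let r := Num.max 1 (Num.max (ft_rmax phi1)
               (Num.max (ft_rmax phi2) (ft_rmax phig))) in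
    let curv := curvatures J Om (eball U0 (2 * gamma)) in
    let D := ProblemData N phig phi1 phi2
               (dm_pairs mg) (dm_pairs m1) (dm_pairs m2)
               rho gamma (enorm U0) (inf curv) (sup curv) in
    forall eps : R, 0 < eps ->
    exists UNN : compfun R n (N * q),
      [/\ is_NN sigma UNN,
          forall x, Om x -> enorm (cf_eval UNN x - Ustar x) <= 3 * eps &
          (cf_size UNN)%:R <=
            C D
            * (q * (#|general_nodes l1| + #|general_nodes l2|
                    + #|general_nodes g|))%:R `^ (2 * r + 1)
            * eps `^ (- (8 * r + 1))].
Proof.
have [K [K0 KG]] := Hsigma.
exists (complexity K); split; first exact: complexity_gt0.
move=> n q N n0 q0 N0 A B g l1 l2 Om Ustar U0 gamma rho mg radg phig m1 rad1 phi1
  m2 rad2 phi2 f J gN l1N l2N gH l1H l2H _ Jinf gamma0 UstarB rho1 Omc ballc bnd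
  gA gF l1A l1F l2A l2F r curv D eps eps0.
have p0 : (0 < N * q)%N by rewrite muln_gt0 N0.
have [coarse_eps|/not_orP[/eqP/set0P Om0 /negP]] :=
  pselect (Om = set0 \/ coarse D <= eps).
  have [G [GN Gs GP]] := zero_NN sigma n (N * q) n0 p0.
  exists G; split=> // [x xO|]; last first.
    by rewrite Gs !mulr_ge0 ?powR_ge0// ltW// complexity_gt0.
  case: coarse_eps => [OE|ce]; first by rewrite OE in xO.
  rewrite GP sub0r enormN -[Ustar x](subrK U0).
  rewrite (le_trans (enorm_triangle _ _ _))//.
  by have := UstarB x xO; rewrite /eball /= => ?; move: ce; rewrite /coarse /=; lra.
rewrite -ltNge => eps_coarse.
have rho0 : 0 <= rho by rewrite ltW// (lt_trans ltr01).
have gC := cf_eval1_C2 n g gN.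
have l1C := cf_eval1_C2 n l1 l1N.
have l2C := cf_eval1_C2 q l2 l2N.
have sc k x U : (k <= N)%N -> Om x -> eball U0 (2 * gamma) U -> cube rho (state f x U k).
  case: k => [_ xO _|k kN xO UB]; first exact: Omc.
  have [sc _] := bnd k.+1 x U kN xO UB; move=> i; apply: le_trans (sc i) _.
  by rewrite ler_pdivrMr//; lra.
have r20 : 0 <= 2 * gamma by rewrite mulr_ge0// ltW.
have [mu0 muM JH] := cost_curvature n q N A B n0 q0 N0 _ _ _ gC l1C l2C gH l1H l2H
  Om U0 (2 * gamma) rho r20 rho0 Om0 ballc sc.
rewrite -/f -/J -/curv in mu0 muM JH.
set mu := inf curv in mu0 muM JH; set M := sup curv in muM JH.
have M0 : 0 < M by exact: lt_le_trans muM.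
have Jmin x U : Om x -> J x (Ustar x) <= J x U.
  move=> xO; rewrite -lee_fin -(Jinf x xO).
  by apply: ereal_inf_lbound; exists U.
have [s sE] : exists s, s = fineness D * eps by exists (fineness D * eps).
have c00 : 0 < Num.min 1 (gamma * mu / (2 * M)).
  by rewrite lt_min ltr01 divr_gt0// mulr_gt0.
have mx0 : 0 < Num.max 1 (coarse D) by rewrite lt_max ltr01.
have fine0 : 0 < fineness D by rewrite divr_gt0.
have s0 : 0 < s by rewrite sE mulr_gt0.
have sc0 : s <= Num.min 1 (gamma * mu / (2 * M)).
  have -> : s = Num.min 1 (gamma * mu / (2 * M)) / Num.max 1 (coarse D) * eps by rewrite sE.
  rewrite -[leLHS]mulrA ler_piMr ?(ltW c00)// mulrC.
  by rewrite ler_pdivrMr// mul1r le_max (ltW eps_coarse) orbT.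
have [s1 sg] : s <= 1 /\ s <= gamma * mu / (2 * M).
  by move: sc0; rewrite le_min => /andP.
have seps : s <= eps.
  rewrite sE ler_piMl ?(ltW eps0)// /fineness ler_pdivrMr// mul1r.
  by rewrite ge_min le_max lexx.
have /andP[k0 k1] := kappa_bounds mu M _ mu0 muM erefl.
set kappa := _ / _ in k0 k1.
have Nq0 : 0 < (N * q)%:R :> R by rewrite ltr0n.
have sg2 : s <= gamma / 2.
  apply: (le_trans sg); rewrite ler_pdivrMr ?mulr_gt0//.
  rewrite (_ : _ / 2 * _ = gamma * M) ?ler_pM2l//; by field.
have sgk : s * M <= gamma * mu / 2.
  rewrite -ler_pdivlMr//; apply: (le_trans sg); rewrite le_eqVlt; apply/orP; left.
  by apply/eqP; field; rewrite gt_eqF.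
have N1 : 1 <= N%:R :> R by rewrite ler1n.
have q1 : 1 <= q%:R :> R by rewrite ler1n.
have Nr0 : 0 < N%:R :> R by rewrite ltr0n.
have qr0 : 0 < q%:R :> R by rewrite ltr0n.
(* The error M t of exact differences and the error due to the inexact cost
   values each take one half of the admissible error mu s / 2 of the gradient. *)
pose t := mu * s / (4 * M * (N * q)%:R).
pose d := mu ^+ 2 * s ^+ 2 / (32 * M * (N * q)%:R ^+ 2 * (2 * N%:R + 1)).
have N21 : 0 < 2 * N%:R + 1 :> R by rewrite addr_gt0// mulr_gt0.
have t0 : 0 < t by apply: divr_gt0; do ?apply: mulr_gt0.
have tk : t <= kappa * gamma / 2.
  have p1 : 1 <= (N * q)%:R :> R by rewrite ler1n.
  rewrite /t ler_pdivrMr ?mulr_gt0//.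
  have -> : kappa * gamma / 2 * (4 * M * (N * q)%:R) = (gamma * mu) * mu / M * (N * q)%:R.
    by rewrite /kappa; field; rewrite gt_eqF.
  apply: (@le_trans _ _ ((gamma * mu) * mu / M)); last first.
    by rewrite ler_peMr// divr_ge0 ?mulr_ge0// ltW.
  by rewrite ler_pdivlMr//; have := gamma0; nra.
have tP : (N * q)%:R * (M * t + 2 * ((2 * N%:R + 1) * d) / t) <= mu * s / 2.
  rewrite le_eqVlt; apply/orP; left; apply/eqP; rewrite /t /d.
  by field; rewrite !gt_eqF.
have [[rg0 Lg0 Mg0 Vg0] Vg _] := gF; have [[r10 L10 M10 V10] V1 _] := l1F.
have [[r20' L20 M20 V20] V2 _] := l2F.
have ne0 dm (phi : features R) : 0 < ft_Lambda phi -> 0 < ft_Lmax phi ->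
    (0 < ft_general phi)%N -> 0 < approximation_factor K dm phi.
  by move=> a b c; rewrite !mulr_gt0// ltr0n.
have ng0 := ne0 (dm_pairs mg) _ Lg0 Mg0 Vg0.
have n10 := ne0 (dm_pairs m1) _ L10 M10 V10.
have n20 := ne0 (dm_pairs m2) _ L20 M20 V20.
have te0 : 0 < total_factor K D by rewrite !addr_gt0.
pose Y := width K D.
have Y1 : 1 <= Y.
  rewrite /Y /width lerDl divr_ge0 ?sqr_ge0// !mulr_ge0 ?sqr_ge0 ?addr_ge0 ?mulr_ge0//;
  exact: ltW.
pose X := Y * (q%:R / s) ^+ 2.
have X1 : 1 <= X.
  rewrite -[leLHS]mulr1 ler_pM// expr_ge1 ?divr_ge0 ?(ltW s0) ?(ltW qr0)//.
  by rewrite ler_pdivlMr// mul1r (le_trans s1).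
have X0 : 0 < X by exact: lt_le_trans X1.
have eX : total_factor K D / X <= d.
  rewrite ler_pdivrMr// /d /X mulrAC ler_pdivlMr; last first.
    by rewrite !mulr_gt0// exprn_gt0.
  have -> : mu ^+ 2 * s ^+ 2 * (Y * (q%:R / s) ^+ 2) = (Y * mu ^+ 2) * q%:R ^+ 2.
    by field; rewrite gt_eqF.
  have -> : total_factor K D * (32 * M * (N * q)%:R ^+ 2 * (2 * N%:R + 1)) =
    (32 * total_factor K D * (2 * N%:R + 1) * M * N%:R ^+ 2) * q%:R ^+ 2.
    by rewrite natrM; ring.
  rewrite ler_wpM2r ?sqr_ge0//.
  have -> : Y * mu ^+ 2 = mu ^+ 2 +
      32 * total_factor K D * (2 * N%:R + 1) * M * N%:R ^+ 2.
    by rewrite /Y /width /= -/mu -/M; field; rewrite gt_eqF.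
  by rewrite lerDr sqr_ge0.
have r1 : 1 <= r by rewrite /r le_max lexx.
have Xr : 1 <= X `^ r.
  rewrite -[leLHS](_ : X `^ 0 = 1); last by rewrite powRr0.
  by apply: ler_powR => //; exact: le_trans r1.
pose nw := (Num.truncn (X `^ r)).+1.
have /andP[nw1 nw2] := truncnS_bounds _ Xr; rewrite -/nw in nw1 nw2.
have nd dm (phi : features R) : 0 < ft_rmax phi -> ft_rmax phi <= r ->
    0 < approximation_factor K dm phi ->
    approximation_factor K dm phi <= total_factor K D ->
    approximation_factor K dm phi * nw%:R `^ (- (ft_rmax phi)^-1) <= d.
  move=> rp rr np nt; apply: le_trans (powR_rate _ _ _ _ _ rp rr X1 nw1 (ltW np)) _.
  by apply: le_trans eX; rewrite ler_wpM2r ?invr_ge0 ?(ltW X0).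
have [hg [g' [hgN hgs gP gd]]] := kang_gong_net sigma K KG _ _ _ _ _ _ gA gF nw isT.
have [h1 [l1' [h1N h1s l1P l1d]]] := kang_gong_net sigma K KG _ _ _ _ _ _ l1A l1F nw isT.
have [h2 [l2' [h2N h2s l2P l2d]]] := kang_gong_net sigma K KG _ _ _ _ _ _ l2A l2F nw isT.
have rr : [/\ ft_rmax phig <= r, ft_rmax phi1 <= r & ft_rmax phi2 <= r].
  by rewrite /r !le_max !lexx !orbT.
have [rrg rr1 rr2] := rr.
have tg := nd _ _ rg0 rrg ng0; have t1 := nd _ _ r10 rr1 n10.
have t2 := nd _ _ r20' rr2 n20.
have {}gd y : cube rho y -> `|g' y - cf_eval1 g y| <= d.
  by move=> yc; apply: le_trans (gd y yc) (tg _);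
    rewrite /total_factor /= -addrA lerDl addr_ge0// ltW.
have {}l1d y : cube rho y -> `|l1' y - cf_eval1 l1 y| <= d.
  by move=> yc; apply: le_trans (l1d y yc) (t1 _);
    rewrite /total_factor /= addrAC lerDr addr_ge0// ltW.
have {}l2d y : cube rho y -> `|l2' y - cf_eval1 l2 y| <= d.
  by move=> yc; apply: le_trans (l2d y yc) (t2 _);
    rewrite /total_factor /= lerDr addr_ge0// ltW.
have ks0 : 0 < kappa * s by rewrite mulr_gt0.
have gks : 1 <= gamma / (kappa * s).
  rewrite ler_pdivlMr// mul1r (le_trans (_ : _ <= s))//; first by rewrite ler_piMl// ltW.
  by rewrite (le_trans sg2)// ler_piMr ?(ltW gamma0)// invf_le1// ler1n.
pose T := (Num.truncn (gamma / (kappa * s))).+1.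
have /andP[T1 T2] := truncnS_bounds _ gks; rewrite -/T in T1 T2.
have Tg : gamma <= s * (1 + T%:R * kappa).
  by rewrite mulrDr mulr1 ler_wpDl ?(ltW s0)// mulrCA [s * kappa]mulrC -ler_pdivrMr.
have [G [GN GP Gs]] := descent_NN sigma n q N A B _ _ g' l1' _ l2' hg h1 h2 Om Ustar U0
  gamma mu M kappa s t d rho T n0 q0 N0 rho0 gC l1C l2C mu0 muM JH Jmin gamma0 UstarB
  ballc sc hgN h1N h2N gP l1P l2P gd l1d l2d erefl s0 sg2 t0 tk tP Tg.
exists G; split=> // [x xO|].
  by rewrite (le_trans (GP x xO))// ler_pM// ?(ltW s0)// ler_nat.
rewrite -V1 -V2 -Vg -/(general_count D).
have Gs' : (cf_size G)%:R <= 1 + T%:R * ((N%:R * q%:R + 1) *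
    (nw%:R * (general_count D)%:R * N%:R)) :> R.
  apply: (@le_trans _ _ (T * ((N * q).+1 * (nw * general_count D * N))).+1%:R).
    rewrite ler_nat (leq_trans Gs)// ltnS !leq_mul// /general_count /=.
    apply: (@leq_trans (N * (nw * ft_general phig) +
       N * (nw * ft_general phi1 + nw * ft_general phi2))%N).
      by rewrite leq_add ?leq_mul ?leq_add// (leq_trans hgs)// leq_pmull.
    by rewrite leq_eqVlt; apply/orP; left; apply/eqP; ring.
  by rewrite -[_.+1]add1n natrD lerD2l !natrM -[(N * q).+1]addn1 natrD natrM.
have := size_bound gamma kappa s q%:R (general_count D)%:R N%:R Y r nw%:R T%:R
  _ gamma0 k0 s0 s1 q1 (ler0n _ _) N1 Y1 (le_trans ler01 r1) (ler0n _ _) (ler0n _ _)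
  (le_trans T2 _) nw2 Gs'.
rewrite mulrA lexx => /(_ isT) H; apply: (le_trans H).
have e1 : s `^ (- (8 * r + 1)) = fineness D `^ (- (8 * r + 1)) * eps `^ (- (8 * r + 1)).
  by rewrite sE powRM// ltW.
rewrite e1 mulrA ler_wpM2r ?powR_ge0//.
rewrite -mulrA [q%:R `^ _ * _]mulrC mulrA.
apply: ler_pM; rewrite ?powR_ge0 ?mulr_ge0 ?powR_ge0//.
- rewrite addr_ge0// divr_ge0 ?(ltW k0)// mulr_ge0 ?powR_ge0// mulr_ge0//.
  by rewrite mulr_ge0 ?sqr_ge0// mulr_ge0// ltW.
- by rewrite /complexity le_max; apply/orP; right; exact: lexx.
- apply: ge0_ler_powR; rewrite ?nnegrE//.
    by rewrite addr_ge0// mulr_ge0// (le_trans ler01 r1).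
  by rewrite ler_nat leq_pmulr// /general_count /= addn_gt0 Vg0 orbT.
Qed.
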